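(* There exists a constant $C$ such that for every sufficiently large $n$ the following holds. If $G$ is a properly edge-colored complete graph on $n$ vertices, then there exists a rainbow cycle in $G$ on at least $n - C(\log n)\sqrt{n}$ vertices.
   Context: An edge-coloring of a graph is a proper edge-coloring if, for each vertex, the edges incident to that vertex are given distinct colors (any number of colors may be used). A subgraph $H$ of an edge-colored graph is rainbow if the colors assigned to the edges of $H$ are pairwise distinct. Logarithms are base $2$. *)

(* Defs.v *)
From mathcomp Require Import all_boot all_order all_algebra.
From mathcomp Require Import reals exp.

Set Implicit Arguments.
Unset Strict Implicit.
Unset Printing Implicit Defensive.

Record sgraph := SGraph {
  vertex :> finType;
  adj : rel vertex;
  adj_sym : symmetric adj;
  adj_irrefl : irreflexive adj
}.
Arguments adj {s}.

Definition complete_graph (G : sgraph) : Prop :=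
  forall x y : G, x != y -> adj x y.

(* An edge is represented by the set of its two endpoints. *)
Definition edges (G : sgraph) : {set {set G}} :=
  [set [set xy.1; xy.2] | xy in [set xy : G * G | adj xy.1 xy.2]].

(* An edge-coloring is a function on all vertex sets, of which only the values
   on edges matter; the type of colors is arbitrary. *)
Definition proper_edge_coloring (G : sgraph) (K : Type) (c : {set G} -> K) :
    Prop :=
  forall v : G, {in [set e in edges G | v \in e] &, injective c}.

(* Repetition-free vertex sequence x_1, ..., x_k with k >= 3, whose cyclically
   consecutive members (including x_k, x_1) are adjacent. *)
Definition graph_cycle (G : sgraph) (s : seq G) : bool :=
  (2 < size s) && ucycleb adj s.

Definition cycle_edges (G : sgraph) (s : seq G) : {set {set G}} :=
  [set [set x; next s x] | x in s].

Definition rainbow (G : sgraph) (K : Type) (c : {set G} -> K)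
    (E : {set {set G}}) : Prop :=
  {in E &, injective c}.

Definition log2 (R : realType) (x : R) : R := (ln x / ln 2)%R.

Lemma cycle_edges_sub (G : sgraph) (s : seq G) :
  graph_cycle s -> cycle_edges s \subset edges G.
Proof.
case/andP=> _ /andP[cyc _]; apply/subsetP=> _ /imsetP[x xs ->].
by apply/imsetP; exists (x, next s x); rewrite // inE /= next_cycle.
Qed.

(* Main.v *)
Require Import Defs.
From mathcomp Require Import all_boot all_order all_algebra.
From mathcomp Require Import reals exp.
From mathcomp Require Import boolp zify lra.

Set Implicit Arguments.
Unset Strict Implicit.
Unset Printing Implicit Defensive.

(* Give every colour an independent random label below N, where N is of order
   sqrt n / log n; the colours labelled 0, 1, 2 are reserved, so every vertex
   has O(sqrt n log n) reserved edges.

   The other colours contain a rainbow forest of about sqrt n / log n paths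
   missing only O(sqrt n log n) vertices.  Otherwise consider the starts
   v_1, v_2, ... of its paths in turn: replacing an edge ab (a before b) by
   v_i b keeps the number of paths and frees the colour of ab, and chains of
   such exchanges free more and more colours until some v_i can be extended by
   an uncovered vertex.

   In each reserved class every set of sqrt n vertices has neighbours almost
   everywhere.  Hence the end of a path can be moved, by two rotations using
   labels 0 and 1, to a vertex joined by an edge of label 2 to any prescribed
   set of sqrt n vertices.  With the vertices of the remaining paths as targets,
   each step appends at least half of one of these paths, so O(sqrt n) reserved
   colours suffice to absorb all but sqrt n of the covered vertices; with an
   initial segment of the long path as target, one more step closes the
   cycle. *)

(** * Paths and their colour sequences *)

Section Paths.
Variable V : eqType.
Implicit Types (p q : seq V) (x y a b : V).

Definition epairs p := zip p (behead p).

Lemma epairs_cat x p y q :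
  epairs ((x :: p) ++ y :: q) =
  epairs (x :: p) ++ (last x p, y) :: epairs (y :: q).
Proof. by elim: p x => //= z p IH x; rewrite -[z :: p]/(z :: p) -IH. Qed.

Lemma epairs_rcons_cat p x y q :
  epairs (rcons p x ++ y :: q) =
  epairs (rcons p x) ++ (x, y) :: epairs (y :: q).
Proof. by case: p => [//|z p]; rewrite rcons_cons epairs_cat last_rcons. Qed.

Lemma epairs_rcons x p y : epairs (rcons (x :: p) y) =
  rcons (epairs (x :: p)) (last x p, y).
Proof. by rewrite -cats1 epairs_cat cats1. Qed.

Lemma epairs_rev p : epairs (rev p) = rev [seq (e.2, e.1) | e <- epairs p].
Proof.
elim: p => [//|x [//|y p] IH].
rewrite -[epairs (x :: _)]/((x, y) :: epairs (y :: p)) map_cons [RHS]rev_cons -IH.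
rewrite rev_cons; have [u [t]] : exists u t, rev (y :: p) = u :: t.
  by case: (rev _) (size_rev (y :: p)) => [//|u t] _; exists u, t.
by move=> E; rewrite E epairs_rcons /= -[in RHS](last_rcons u (rev p) y) -rev_cons E.
Qed.

Lemma size_epairs p : size (epairs p) = (size p).-1.
Proof. by rewrite size_zip size_behead; apply/minn_idPr; rewrite leq_pred. Qed.

Lemma mem_epairs p x y : (x, y) \in epairs p -> (x \in p) /\ (y \in p).
Proof.
elim: p => [//|z [//|w p] IH] /=; rewrite inE -/(epairs (w :: p)).
by case/predU1P=> [[-> ->]|/IH[]]; rewrite !inE ?eqxx ?orbT // => -> ->; rewrite !orbT.
Qed.

Lemma epairs_split p x y : (x, y) \in epairs p ->
  exists q r, p = rcons q x ++ y :: r.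
Proof.
elim: p => [//|z [//|w p] IH] /=; rewrite inE -/(epairs (w :: p)).
case/predU1P=> [[-> ->]|/IH[q [r ->]]]; first by exists [::], p.
by exists (z :: q), r.
Qed.

Lemma epairs_next p x y : uniq p -> (x, y) \in epairs p -> next p x = y.
Proof.
move=> up /epairs_split[q [r def_p]]; move: def_p up => ->; rewrite cat_rcons.
elim/last_ind: q => [|q z _] up; first by rewrite next_nth mem_head /= eqxx.
rewrite -(next_rot (size (rcons q z)) up) rot_size_cat.
by rewrite next_nth mem_head /= eqxx.
Qed.

Lemma epairs_prev p x y : uniq p -> (x, y) \in epairs p -> prev p y = x.
Proof. by move=> up /(epairs_next up) <-; rewrite prev_next. Qed.

Lemma next_epairs x p z : uniq (x :: p) -> z \in x :: p -> z != last x p ->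
  (z, next (x :: p) z) \in epairs (x :: p).
Proof.
move=> up zp zl.
have [q [w [r def_p]]] : exists q w r, x :: p = rcons q z ++ w :: r.
  have [q [r def_p]] : exists q r, x :: p = q ++ z :: r.
    by case/splitPr: zp => q r; exists q, r.
  case: r def_p => [|w r] def_p; last by exists q, w, r; rewrite cat_rcons.
  by move: zl; rewrite -[last x p]/(last x (x :: p)) def_p last_cat eqxx.
have zw : (z, w) \in epairs (x :: p).
  by rewrite def_p epairs_rcons_cat mem_cat mem_head orbT.
by rewrite (epairs_next up zw).
Qed.

Lemma epairs_prefix p q e : e \in epairs p -> e \in epairs (p ++ q).
Proof.
case: p => [//|x p]; case: q => [|y q]; first by rewrite cats0.
by rewrite epairs_cat mem_cat => ->.
Qed.

(** Exchanges reverse parts of paths, so the survival of an edge is tracked only up to orientation;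
    [epairs] keeps the direction where it matters. *)
Definition joined p x y := ((x, y) \in epairs p) || ((y, x) \in epairs p).

Lemma joined_rev p x y : joined (rev p) x y = joined p x y.
Proof.
have mem_rev_epairs u w : ((u, w) \in epairs (rev p)) = ((w, u) \in epairs p).
  rewrite epairs_rev mem_rev; apply/mapP/idP => [[[c d] /= cd [-> ->]] //|wu].
  by exists (w, u).
by rewrite /joined !mem_rev_epairs orbC.
Qed.

Lemma joined_cat p a b q x y : joined (rcons p a ++ b :: q) x y =
  [|| joined (rcons p a) x y, (x, y) == (a, b), (y, x) == (a, b)
    | joined (b :: q) x y].
Proof.
rewrite /joined epairs_rcons_cat !mem_cat !inE.
by do !case: (_ \in _); rewrite ?orbT ?orbF //=; do !case: (_ == _).
Qed.

(** What ends at [x] shares no vertex with what begins at [y]. Exchanges depend on this direction,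
    and the case [x = y] rules out loops. *)
Lemma uniq_epairs_oriented p x y : uniq p ->
  (x, y) \in epairs p -> (y, x) \in epairs p -> False.
Proof.
move=> up /epairs_split[q [r def_p]]; rewrite def_p in up *.
suff: (y, x) \notin epairs (rcons q x ++ y :: r) by move/negP.
move: up; rewrite cat_uniq epairs_rcons_cat mem_cat inE xpair_eqE => /and3P[_ dis uy].
have yq : y \notin rcons q x by apply: (hasPn dis); rewrite mem_head.
have xr : x \notin y :: r.
  by apply/negP => xr; move/hasPn/(_ _ xr): dis; rewrite mem_rcons mem_head.
apply/norP; split; first by apply/negP=> /mem_epairs[]; rewrite (negPf yq).
apply/norP; split; last by apply/negP=> /mem_epairs[_]; rewrite (negPf xr).
by apply/negP=> /andP[/eqP yx _]; move: xr; rewrite -yx mem_head.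
Qed.

End Paths.

Section ColoredPaths.
Variables (V C : eqType) (col : V -> V -> C).
Hypothesis col_sym : forall x y, col x y = col y x.
Implicit Types (p q : seq V) (P : seq (seq V)).

Definition pcols p := [seq col e.1 e.2 | e <- epairs p].

Definition cols P := flatten [seq pcols p | p <- P].

Lemma pcols_cat x p y q :
  pcols ((x :: p) ++ y :: q) =
  pcols (x :: p) ++ col (last x p) y :: pcols (y :: q).
Proof. by rewrite /pcols epairs_cat map_cat. Qed.

Lemma pcols_rcons_cat p x y q :
  pcols (rcons p x ++ y :: q) =
  pcols (rcons p x) ++ col x y :: pcols (y :: q).
Proof. by rewrite /pcols epairs_rcons_cat map_cat. Qed.

Lemma pcols_rcons x p y :
  pcols (rcons (x :: p) y) = rcons (pcols (x :: p)) (col (last x p) y).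
Proof. by rewrite /pcols epairs_rcons map_rcons. Qed.

Lemma pcols_rev p : pcols (rev p) = rev (pcols p).
Proof.
rewrite /pcols epairs_rev map_rev -map_comp.
by congr rev; apply: eq_map => e /=; rewrite col_sym.
Qed.

Lemma cols_cons p P : cols (p :: P) = pcols p ++ cols P.
Proof. by []. Qed.

Lemma perm_cols P Q : perm_eq P Q -> perm_eq (cols P) (cols Q).
Proof. by move=> PQ; apply: perm_flatten; apply: perm_map. Qed.

Lemma size_cols P : all (fun p => p != [::]) P ->
  size (cols P) + size P = size (flatten P).
Proof.
elim: P => //= p P IH /andP[p0 P0]; rewrite cols_cons !size_cat -IH // size_map.
rewrite size_epairs; case: p p0 => //= x p _; lia.
Qed.

(** Cutting [q] next to [b] keeps the longer side attached to [b], reversed if necessary so that [b]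
    comes first; the shorter side is [r]. [D] holds the colour of the edge lost, if any. *)
Lemma half_split q b : b \in q -> exists t r,
  [/\ perm_eq (b :: t ++ r) q, 2 * size r < size q
    & exists D, perm_eq (D ++ pcols (b :: t) ++ pcols r) (pcols q)].
Proof.
case/splitPr=> q1 q2; have [le12|lt21] := leqP (size q1) (size q2).
  exists q2, q1; split; first by rewrite -cat_cons perm_catC.
    by rewrite size_cat /=; lia.
  elim/last_ind: q1 {le12} => [|q1 a _]; first by exists [::]; rewrite cats0.
  exists [:: col a b]; rewrite pcols_rcons_cat.
  by apply/permP=> g; rewrite /= ?count_cat /= ?count_cat; lia.
exists (rev q1), q2; split.
- by rewrite -cat_cons -rev_rcons -cat_rcons perm_cat2r perm_rev.
- by rewrite size_cat /=; lia.
rewrite -rev_rcons pcols_rev -cat_rcons.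
case: q2 {lt21} => [|c q2].
  by exists [::]; rewrite /= !cats0 perm_rev.
exists [:: col b c]; rewrite pcols_rcons_cat.
by apply/permP=> g; rewrite /= ?(count_cat, count_rev) /= ?(count_cat, count_rev); lia.
Qed.

End ColoredPaths.

(** * Rainbow path forests *)

Section Forest.
Variables (V C : finType) (col : V -> V -> C) (W : pred C).
Hypothesis col_sym : forall x y, col x y = col y x.
Hypothesis col_inj : forall x y z, x != y -> x != z -> col x y = col x z -> y = z.
Implicit Types (p q : seq V) (P Q : seq (seq V)) (a b v x y : V).

Definition rainbow_forest P :=
  [&& all (fun p => p != [::]) P, uniq (flatten P),
      uniq (cols col P) & all W (cols col P)].

Lemma rainbow_forest_sub P Q c : rainbow_forest P -> W c -> c \notin cols col P ->
  all (fun p => p != [::]) Q -> uniq (flatten Q) ->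
  (exists D, perm_eq (D ++ cols col Q) (c :: cols col P)) -> rainbow_forest Q.
Proof.
case/and4P=> _ _ uP WP Wc cP Q0 uQ [D DQ]; rewrite /rainbow_forest Q0 uQ /=.
have: uniq (c :: cols col P) by rewrite /= cP.
have: all W (c :: cols col P) by rewrite /= Wc.
rewrite -(perm_uniq DQ) -(perm_all _ DQ) all_cat cat_uniq.
by case/andP=> _ -> /and3P[_ _ ->].
Qed.

(* [Q] arises from [P] by adding the edge [v b], where [p] starts at [v], and
   deleting [a b]. *)
Definition switch_spec P Q p v a b :=
  [/\ size Q = size P, perm_eq (flatten Q) (flatten P),
      perm_eq (col a b :: cols col Q) (col v b :: cols col P)
    & all (fun p => p != [::]) Q] /\
  (forall q x y, q \in P -> joined q x y -> col x y != col a b ->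
     exists2 q', q' \in Q & joined q' x y) /\
  (forall q, q \in P -> q != p -> (b, a) \notin epairs q ->
     exists s t, [/\ q = s ++ t, s != [::] & s \in Q]).

(** The initial segment up to [a] is reversed, so that [v] meets [b]. This needs [a] before [b]: in
    the other direction the new edge would close a cycle. *)
Lemma switch_self P v p a b : (v :: p) \in P -> (a, b) \in epairs (v :: p) ->
  all (fun p => p != [::]) P ->
  exists Q, switch_spec P Q (v :: p) v a b.
Proof.
move=> pP /epairs_split[s [t def_p]] P0; have Pp := perm_to_rem pP.
move: (rem _ _) Pp => R Pp.
have [s' def_s] : exists s', rcons s a = v :: s'.
  by case: s def_p => [|w s] [<- _]; [exists [::] | exists (rcons s a)].
have R0 : all (fun p => p != [::]) R.
  by move: P0; rewrite (perm_all _ Pp) => /andP[].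
pose Q := (rev (rcons s a) ++ b :: t) :: R; exists Q.
split; [split|split].
- by rewrite (perm_size Pp).
- rewrite (permPr (perm_flatten Pp)) /= -cat_cons def_p perm_cat2r perm_cat2r.
  by rewrite perm_rev.
- have := perm_cols col Pp; rewrite -(perm_cons (col v b)) => /permPr->.
  rewrite !cols_cons def_p [pcols _ (rcons s a ++ _)]pcols_rcons_cat def_s.
  rewrite rev_cons pcols_rcons_cat -rev_cons (pcols_rev col_sym).
  apply/permP=> f; rewrite /= !count_cat /= count_rev.
  lia.
- by rewrite /= R0 andbT; case: (rev _).
- move=> q x y; rewrite (perm_mem Pp) inE => /predU1P[->|qR] qxy nab; last first.
    by exists q; rewrite // inE qR orbT.
  exists (rev (rcons s a) ++ b :: t); rewrite ?mem_head //.
  rewrite def_s rev_cons joined_cat -rev_cons -def_s joined_rev.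
  move: qxy; rewrite def_p joined_cat.
  case/or4P=> [->|/eqP[xa yb]|/eqP[ya xb]|->] //; rewrite ?orbT //.
    by move: nab; rewrite xa yb eqxx.
  by move: nab; rewrite ya xb col_sym eqxx.
- move=> q; rewrite (perm_mem Pp) inE => /predU1P[->|qR] qp _.
    by rewrite eqxx in qp.
  exists q, [::]; rewrite cats0 inE qR orbT; split=> //.
  by apply: (allP R0).
Qed.

(** If [a] comes first, the path of [v] is reversed and put in front of the part starting at [b];
    otherwise it is appended to the part ending at [b]. In the second case no initial segment of
    [q0] need remain as a path, whence the orientation condition in [switch_spec]. *)
Lemma switch_other P v p q0 a b : (v :: p) \in P -> q0 \in P ->
  q0 != v :: p -> joined q0 a b -> all (fun p => p != [::]) P ->
  exists Q, switch_spec P Q (v :: p) v a b.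
Proof.
move=> pP q0P q0p q0ab P0.
have [R Pp] : exists R, perm_eq P [:: v :: p, q0 & R].
  exists (rem q0 (rem (v :: p) P)); apply: (perm_trans (perm_to_rem pP)).
  rewrite perm_cons; apply: perm_to_rem.
  by move: q0P; rewrite (perm_mem (perm_to_rem pP)) inE (negPf q0p).
have R0 : all (fun p => p != [::]) R.
  by move: P0; rewrite (perm_all _ Pp) => /and3P[].
have inP q : q \in P -> [\/ q = v :: p, q = q0 | q \in R].
  rewrite (perm_mem Pp) !inE => /or3P[/eqP|/eqP|]; first by constructor 1.
    by constructor 2.
  by constructor 3.
case/orP: q0ab => /epairs_split[s [t def_q]].
- pose p1 := rcons (rev p) v ++ b :: t.
  exists [:: rcons s a, p1 & R]; split; [split|split].
  + by rewrite (perm_size Pp).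
  + rewrite (permPr (perm_flatten Pp)) /= def_q /p1 -rev_cons.
    apply/permP=> f;
      rewrite /= ?(count_cat, count_rev) /= ?(count_cat, count_rev) /=; lia.
  + have := perm_cols col Pp; rewrite -(perm_cons (col v b)) => /permPr->.
    rewrite !cols_cons def_q !pcols_rcons_cat -rev_cons (pcols_rev col_sym).
    apply/permP=> f;
      rewrite /= ?(count_cat, count_rev) /= ?(count_cat, count_rev) /=; lia.
  + by rewrite /= R0 /p1; case: (s) => [|? ?]; case: (rev p).
  + move=> q x y /inP[->|->|qR] qxy nab; last first.
    * by exists q; rewrite // !inE qR !orbT.
    * move: qxy; rewrite def_q joined_cat => /or4P[j|/eqP[xa yb]|/eqP[ya xb]|j].
      - by exists (rcons s a); rewrite ?mem_head.
      - by move: nab; rewrite xa yb eqxx.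
      - by move: nab; rewrite ya xb col_sym eqxx.
      - by exists p1; rewrite ?inE ?eqxx ?orbT // joined_cat j !orbT.
    * exists p1; rewrite ?inE ?eqxx ?orbT // joined_cat -rev_cons joined_rev.
      by rewrite qxy.
  + move=> q /inP[->|->|qR] qp _.
    * by rewrite eqxx in qp.
    * exists (rcons s a), (b :: t); split=> //; last exact: mem_head.
      by case: (s).
    * exists q, [::]; rewrite cats0 !inE qR !orbT; split=> //.
      by apply: (allP R0).
- pose p1 := rcons s b ++ v :: p.
  exists [:: p1, a :: t & R]; split; [split|split].
  + by rewrite (perm_size Pp).
  + rewrite (permPr (perm_flatten Pp)) /= def_q /p1.
    apply/permP=> f;
      rewrite /= ?(count_cat, count_rev) /= ?(count_cat, count_rev) /=; lia.
  + have := perm_cols col Pp; rewrite -(perm_cons (col v b)) => /permPr->.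
    rewrite !cols_cons def_q !pcols_rcons_cat (col_sym b v) (col_sym a b).
    apply/permP=> f;
      rewrite /= ?(count_cat, count_rev) /= ?(count_cat, count_rev) /=; lia.
  + by rewrite /= R0 /p1; case: (s) => [|? ?].
  + move=> q x y /inP[->|->|qR] qxy nab; last first.
    * by exists q; rewrite // !inE qR !orbT.
    * move: qxy; rewrite def_q joined_cat => /or4P[j|/eqP[xb ya]|/eqP[yb xa]|j].
      - by exists p1; rewrite ?mem_head // joined_cat j.
      - by move: nab; rewrite xb ya col_sym eqxx.
      - by move: nab; rewrite yb xa eqxx.
      - by exists (a :: t); rewrite ?inE ?eqxx ?orbT.
    * by exists p1; rewrite ?mem_head // joined_cat qxy !orbT.
  + move=> q /inP[->|->|qR] qp nba.
    * by rewrite eqxx in qp.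
    * by move: nba; rewrite def_q epairs_rcons_cat mem_cat mem_head orbT.
    * exists q, [::]; rewrite cats0 !inE qR !orbT; split=> //.
      by apply: (allP R0).
Qed.

Lemma uniq_flatten_nth P i j x : uniq (flatten P) ->
  x \in nth [::] P i -> x \in nth [::] P j -> i = j.
Proof.
elim: P i j => [|p P IH] [|i] [|j] //=; rewrite cat_uniq => /and3P[_ dis uP].
- move=> xp xj; move/hasPn/(_ x): dis; rewrite xp => /(_ _) /negP; case; last by [].
  apply/flattenP; exists (nth [::] P j) => //; apply: mem_nth.
  by rewrite ltnNge; apply: contraL xj => /(nth_default _) ->.
- move=> xi xp; move/hasPn/(_ x): dis; rewrite xp => /(_ _) /negP; case; last by [].
  apply/flattenP; exists (nth [::] P i) => //; apply: mem_nth.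
  by rewrite ltnNge; apply: contraL xi => /(nth_default _) ->.
- by move=> xi xj; congr _.+1; apply: IH xi xj.
Qed.

Lemma uniq_flatten_mem P p q x : uniq (flatten P) -> p \in P -> q \in P ->
  x \in p -> x \in q -> p = q.
Proof.
move=> uP pP qP xp xq.
have /(_ uP) := @uniq_flatten_nth P (index p P) (index q P) x.
by rewrite !nth_index // => /(_ xp xq) E; rewrite -(nth_index [::] pP) E nth_index.
Qed.

Lemma uniq_flatten_uniq P p : uniq (flatten P) -> p \in P -> uniq p.
Proof.
elim: P => //= q P IH; rewrite cat_uniq inE => /and3P[uq _ uP].
by case/predU1P=> [->|] //; apply: IH.
Qed.

(* [gamma] is freed when some forest with the same vertices and as many paths
   avoids it; the last two clauses keep the surgery iterable at the starts of
   the paths of index at least [i]. *)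
Definition freeable P i (F : {set C}) := forall gamma, W gamma ->
  (gamma \notin cols col P) || (gamma \in F) ->
  exists Q,
  [/\ rainbow_forest Q, size Q = size P, perm_eq (flatten Q) (flatten P)
    & gamma \notin cols col Q] /\
  (forall q x y, q \in P -> joined q x y -> col x y \notin F ->
     exists2 q', q' \in Q & joined q' x y) /\
  (forall k, i <= k < size P ->
     exists s t, [/\ nth [::] P k = s ++ t, s != [::] & s \in Q]).

Lemma freeable0 P : rainbow_forest P -> freeable P 0 set0.
Proof.
move=> fP c _; rewrite inE orbF => cP; exists P; split=> //; split.
  by move=> q x y qP qxy _; exists q.
move=> k /andP[_ kP]; exists (nth [::] P k), [::]; rewrite cats0 mem_nth //.
split=> //; have /and4P[P0 _ _ _] := fP.
by apply: (allP P0); apply: mem_nth.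
Qed.

(** To free the colour of the edge [ab], first free that of [vb], then exchange [ab] for [vb]. The
    edge [ab] survives the first stage because its colour is outside [F], and [v] still starts a
    path there by the clause for index [i]. *)
Lemma freeableS P i (F F' : {set C}) v p : rainbow_forest P -> i < size P ->
  nth [::] P i = v :: p -> freeable P i F -> F \subset F' ->
  (forall c, c \in F' -> c \notin F -> exists a b q,
    [/\ q \in P, (a, b) \in epairs q, col a b = c, W (col v b)
      & (col v b \notin cols col P) || (col v b \in F)]) ->
  freeable P i.+1 F'.
Proof.
move=> fP iP Pi free FF' newF c Wc cfree.
have [/and4P[_ uP _ WP]] := fP.
have [cF|] := boolP ((c \notin cols col P) || (c \in F)).
  have [Q [HQ [QJ QP]]] := free c Wc cF; exists Q; split=> //; split.
    by move=> q x y qP qxy cF'; apply: QJ qP qxy _; apply: contra cF'; apply/subsetP.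
  by move=> k /andP[/ltnW ik kP]; apply: QP; rewrite ik.
rewrite negb_or negbK => /andP[cP ncF].
have cF' : c \in F' by move: cfree; rewrite cP.
have [a [b [q [qP qab abc Wvb vbfree]]]] := newF c cF' ncF.
have [Q [[fQ sQ pQ vbQ] [QJ QP]]] := free _ Wvb vbfree.
have [|s [t [Pist s0 sQ']]] := QP i; first by rewrite leqnn.
have [p' def_s] : exists p', s = v :: p'.
  by case: s s0 Pist {sQ'} => [//|w s] _; rewrite Pi => -[<- _]; exists s.
(* The pieces known to survive are prefixes of paths of [P], where [a] precedes [b]; so none of them
   contains the pair in the order [b], [a]. *)
have oriented k s' t' : nth [::] P k = s' ++ t' -> k < size P ->
    (b, a) \notin epairs s'.
  move=> Pk kP; apply/negP=> /(epairs_prefix t'); rewrite -Pk => ba.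
  have [aq _] := mem_epairs qab; have [_ ak] := mem_epairs ba.
  have E := uniq_flatten_mem uP qP (mem_nth _ kP) aq ak.
  by apply: uniq_epairs_oriented qab _; rewrite ?E // -E (uniq_flatten_uniq uP).
have qjab : joined q a b by rewrite /joined qab.
have [|q' q'Q q'ab] := QJ _ _ _ qP qjab; first by rewrite abc.
have /and4P[Q0 uQ _ _] := fQ.
have [Q2 [[sQ2 pQ2 cQ2 Q20] [Q2J Q2P]]] : exists Q2, switch_spec Q Q2 (v :: p') v a b.
  have [E|neq] := eqVneq q' (v :: p').
    apply: switch_self; rewrite -?def_s //.
    have := q'ab; rewrite E -def_s /joined => /orP[//|ba].
    by have := oriented _ _ _ Pist iP; rewrite ba.
  by apply: switch_other q'ab Q0; rewrite -?def_s // def_s.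
have fQ2 : rainbow_forest Q2.
  apply: rainbow_forest_sub fQ Wvb vbQ Q20 _ _; first by rewrite (perm_uniq pQ2).
  by exists [:: col a b].
exists Q2; split; [split=> //|split].
- by rewrite sQ2.
- exact: perm_trans pQ2 pQ.
- have : uniq (col v b :: cols col Q) by case/and4P: fQ => _ _ uc _; rewrite /= vbQ.
  by rewrite -(perm_uniq cQ2) /= abc => /andP[].
- move=> r x y rP rxy xyF'.
  have [|r' r'Q r'xy] := QJ _ _ _ rP rxy.
    by apply: contra xyF'; apply/subsetP.
  by apply: Q2J r'Q r'xy _; apply: contraNneq xyF' => ->; rewrite abc.
move=> k /andP[ik kP]; have [|s1 [t1 [Pk s10 s1Q]]] := QP k; first by rewrite ltnW.
have [|s2 [t2 [s12 s20 s2Q]]] := Q2P _ s1Q _ (oriented _ _ _ Pk kP).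
  apply: contraTneq ik => E; rewrite -leqNgt.
  suff -> : k = i by [].
  apply: (@uniq_flatten_nth P k i v uP); first by rewrite Pk E mem_head.
  by rewrite Pi mem_head.
by exists s2, (t2 ++ t1); rewrite catA -s12.
Qed.

Lemma rainbow_forest_attach P Q v s u : rainbow_forest Q ->
  perm_eq (flatten Q) (flatten P) -> (v :: s) \in Q -> u \notin flatten P ->
  W (col v u) -> col v u \notin cols col Q ->
  exists2 Q', rainbow_forest Q' &
    size Q' = size Q /\ size (flatten Q') = (size (flatten P)).+1.
Proof.
move=> fQ pQ sQ uP Wvu vuQ; have Qr := perm_to_rem sQ.
have pr := perm_flatten Qr; have cr := perm_cols col Qr.
exists ((u :: v :: s) :: rem (v :: s) Q); last first.
  by rewrite /= (perm_size Qr) -(perm_size pQ) (perm_size pr).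
have /and4P[Q0 uQ _ _] := fQ.
apply: rainbow_forest_sub fQ Wvu vuQ _ _ _.
- by move: Q0; rewrite (perm_all _ Qr).
- rewrite -[flatten _]/(u :: flatten ((v :: s) :: rem (v :: s) Q)) cons_uniq.
  by rewrite -(perm_uniq pr) uQ -(perm_mem pr) (perm_mem pQ) uP.
- exists [::]; rewrite cols_cons -[pcols _ (u :: _)]/(col u v :: pcols col (v :: s)).
  by rewrite col_sym perm_cons perm_sym (permPl cr).
Qed.

Lemma cols_map P :
  cols col P = [seq col e.1 e.2 | e <- flatten [seq epairs p | p <- P]].
Proof. by rewrite map_flatten -map_comp. Qed.

Lemma unzip2_epairs P :
  [seq e.2 | e <- flatten [seq epairs p | p <- P]] = flatten [seq behead p | p <- P].
Proof.
rewrite map_flatten -map_comp; congr flatten; apply: eq_map => p /=.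
by rewrite [LHS]unzip2_zip // size_behead leq_pred.
Qed.

Variable d : nat.
Hypothesis d_gt0 : 0 < d.
Hypothesis W_codeg : forall x, #|[set y | (y != x) && ~~ W (col x y)]| <= d.

(** If no uncovered vertex can be joined to the start [v] in an absent or freed colour, all such
    edges at [v] lead to covered vertices. Each [b] among them that is not a start frees the colour
    of the path edge entering [b]. *)
Lemma freed_step P i (F : {set C}) :
  rainbow_forest P -> size (flatten P) + 4 * d < #|V| ->
  i < size P -> F \subset cols col P -> freeable P i F ->
  (exists2 Q, rainbow_forest Q &
    size Q = size P /\ size (flatten Q) = (size (flatten P)).+1) \/
  exists F' : {set C},
    [/\ F' \subset cols col P, #|F| + 2 * d <= #|F'| & freeable P i.+1 F'].
Proof.
move=> fP Psmall iP FP free; have /and4P[P0 uP ucP WP] := fP.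
case Pi : (nth [::] P i) => [|v p].
  by have := allP P0 _ (mem_nth [::] iP); rewrite Pi.
have PiP : v :: p \in P by rewrite -Pi mem_nth.
have vP : v \in flatten P by apply/flattenP; exists (v :: p); rewrite ?mem_head.
pose ok u := W (col v u) && ((col v u \notin cols col P) || (col v u \in F)).
have [/existsP[u /andP[uP' /andP[Wu cu]]]|noext] :=
  boolP [exists u, (u \notin flatten P) && ok u].
  left; have [Q [[fQ sQ pQ cQ] [_ QP]]] := free _ Wu cu.
  have [|s [t [Pist s0 sQ']]] := QP i; first by rewrite leqnn.
  have def_s : exists s', s = v :: s'.
    by case: s s0 Pist {sQ'} => [//|w s] _; rewrite Pi => -[<- _]; exists s.
  have [s' {}def_s] := def_s; rewrite def_s in sQ'.
  have [Q' fQ' [sQ2 sz]] := rainbow_forest_attach fQ pQ sQ' uP' Wu cQ.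
  by exists Q'; rewrite // sQ2 sQ.
right; pose B := [set b | [&& b \in flatten [seq behead q | q <- P], b != v & ok b]].
pose Es := flatten [seq epairs q | q <- P].
pose l := [seq e <- Es | e.2 \in B].
pose F2 := [set c in [seq col e.1 e.2 | e <- l]].
have subl : subseq [seq col e.1 e.2 | e <- l] (cols col P).
  by rewrite cols_map; apply: map_subseq; apply: filter_subseq.
have cardF2 : #|B| <= #|F2|.
  have -> : #|F2| = size l.
    rewrite cardsE -(size_map (fun e => col e.1 e.2)).
    by apply/card_uniqP/(subseq_uniq subl).
  rewrite -(size_map (fun e => e.2) l) cardE; apply: uniq_leq_size (enum_uniq _) _.
  move=> b; rewrite mem_enum => bB.
  have : b \in [seq e.2 | e <- Es].
    by rewrite unzip2_epairs; move: bB; rewrite inE => /andP[].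
  by case/mapP=> e eE be; apply/mapP; exists e; rewrite // mem_filter -be bB.
have cardB : #|F| + 2 * d <= #|B|.
  (* [N1] and [N2] are the vertices lost to reserved colours and to used colours outside [F], and
     [H] is the set of starts. As edges and paths together number the covered vertices, the bounds
     on these sets force [B] to be large. *)
  pose N1 := [set y | (y != v) && ~~ W (col v y)].
  pose N2 := [set y | [&& y != v, col v y \in cols col P & col v y \notin F]].
  pose H := [set x in [seq head v q | q <- P]].
  have cover : [set: V] \subset [set v] :|: N1 :|: N2 :|: H :|: B.
    apply/subsetP=> u _; rewrite !in_setU in_set1.
    have [//|uv] := eqVneq u v.
    rewrite [u \in N1]inE uv /=; have [Wu|//] := boolP (W (col v u)).
    rewrite [u \in N2]inE uv /=.
    case: (boolP (_ && _)) => [//|] /=.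
    rewrite negb_and negbK => cu.
    have oku : ok u by rewrite /ok Wu.
    have /flattenP[q qP uq] : u \in flatten P.
      by move/existsPn/(_ u): noext; rewrite oku andbT negbK.
    case: q uq qP => [//|h q]; rewrite inE => /predU1P[->|uq] qP.
      by rewrite [h \in H]inE; apply/orP; left; apply/mapP; exists (h :: q).
    rewrite [u \in B]inE uv oku !andbT orbC.
    by apply/orP; left; apply/flattenP; exists q => //; apply/mapP; exists (h :: q).
  have := subset_leq_card cover; rewrite cardsT => cover_le.
  have cardN2 : #|N2| + #|F| <= size (cols col P).
    have injN2 : {in N2 &, injective (col v)}.
      move=> y z; rewrite !inE => /andP[yv _] /andP[zv _].
      by apply: col_inj; rewrite eq_sym.
    rewrite -(card_in_imset injN2).
    have dis : (col v @: N2) :&: F = set0.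
      apply/setP=> c; rewrite !inE; apply/negP=> /andP[/imsetP[y]].
      by rewrite inE => /and3P[_ _ yF] -> ; rewrite (negPf yF).
    have := cardsU (col v @: N2) F; rewrite dis cards0 subn0 => <-.
    apply: leq_trans (card_size (cols col P)); apply: subset_leq_card.
    apply/subsetP=> c; rewrite inE => /orP[/imsetP[y + ->]|/(subsetP FP)//].
    by rewrite inE => /and3P[].
  have cardH : #|H| <= size P by rewrite cardsE -(size_map (head v)); apply: card_size.
  have cardU (A A' : {set V}) m : #|A| <= m -> #|A :|: A'| <= m + #|A'|.
    by move=> Am; apply: leq_trans (leq_card_setU _ _).1 _; rewrite leq_add2r.
  have N1d : #|N1| <= d := W_codeg v.
  have szP := size_cols col P0.
  have {}cover_le := leq_trans cover_le
    (cardU _ _ _ (cardU _ _ _ (cardU _ _ _ (cardU _ _ _ (leqnn #|[set v]|))))).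
  have arith n sf sc r f n1 n2 h k : sf + 4 * d < n -> n2 + f <= sc -> n1 <= d ->
    sc + r = sf -> n <= 1 + n1 + n2 + h + k -> h <= r -> f + 2 * d <= k by lia.
  by rewrite cards1 in cover_le; apply: arith Psmall cardN2 N1d szP cover_le cardH.
exists (F :|: F2); split.
- apply/subsetP=> c; rewrite inE => /orP[/(subsetP FP)//|].
  by rewrite inE; apply: (mem_subseq subl).
- apply: leq_trans cardB (leq_trans cardF2 _).
  by apply: subset_leq_card; apply: subsetUr.
- apply: (freeableS fP iP Pi free (subsetUl _ _)) => c.
  rewrite inE => /orP[-> //|]; rewrite inE => /mapP[[a b]].
  rewrite mem_filter /= => /andP[bB /flattenP[_ /mapP[q qP ->] ab]] -> _.
  exists a, b, q; split=> //; move: bB; rewrite inE => /and3P[_ _ /andP[]] //.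
Qed.

Hypothesis V_gt0 : 0 < #|V|.

(** Each start frees at least [2 * d] more colours, so passing all starts would free at least
    [2 * #|V|] colours, more than [P] has edges; hence some start can be extended. *)
Lemma rainbow_forest_grow P : rainbow_forest P ->
  size (flatten P) + 4 * d < #|V| -> #|V| <= size P * d ->
  exists2 Q, rainbow_forest Q &
    size Q = size P /\ size (flatten Q) = (size (flatten P)).+1.
Proof.
move=> fP Psmall rd.
suff /(_ (size P)) [//|//|[F [FP cardF _]]] : forall i, i <= size P ->
  (exists2 Q, rainbow_forest Q &
    size Q = size P /\ size (flatten Q) = (size (flatten P)).+1) \/
  exists F : {set C}, [/\ F \subset cols col P, 2 * d * i <= #|F| & freeable P i F].
  have /and4P[P0 _ _ _] := fP.
  have arith n sf sc r f : sf + 4 * d < n -> n <= r * d -> f <= sc ->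
    sc + r = sf -> 2 * d * r <= f -> False by nia.
  case: (arith _ _ _ _ _ Psmall rd _ (size_cols col P0) cardF).
  exact: leq_trans (subset_leq_card FP) (card_size _).
elim=> [_|i IH iP]; first right.
  exists set0; rewrite muln0; split=> //; last exact: freeable0.
  by apply/subsetP=> c; rewrite inE.
have [|//|[F [FP cardF free]]] := IH; [exact: ltnW|by left|].
have [|[F' [FP' cardF' free']]] := freed_step fP Psmall iP FP free; first by left.
by right; exists F'; split=> //; lia.
Qed.

Lemma rainbow_forest_exists r : r <= #|V| -> #|V| <= r * d ->
  exists P, [/\ rainbow_forest P, size P = r & #|V| <= size (flatten P) + 4 * d].
Proof.
move=> rn rd.
(* The initial forest consists of [r] one-vertex paths. *)
have [P0 fP0 sP0] : exists2 P, rainbow_forest P & size P = r.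
  exists [seq [:: x] | x <- take r (enum V)]; last first.
    by rewrite size_map size_takel // -cardE.
  have c0 (s : seq V) : cols col [seq [:: x] | x <- s] = [::] by elim: s.
  rewrite /rainbow_forest c0 /= andbT; apply/andP; split; first by elim: (take _ _).
  have -> (s : seq V) : flatten [seq [:: x] | x <- s] = s.
    by elim: s => //= x s ->.
  by rewrite take_uniq // enum_uniq.
suff grow k : forall P, rainbow_forest P -> size P = r ->
    #|V| <= size (flatten P) + 4 * d + k -> exists P,
    [/\ rainbow_forest P, size P = r & #|V| <= size (flatten P) + 4 * d].
  by apply: (grow #|V| P0); rewrite // leq_addl.
elim: k => [|k IH] P fP sP big; first by exists P; rewrite addn0 in big.
have [small|] := ltnP (size (flatten P) + 4 * d) #|V|; last by exists P.
have [|Q fQ [sQ szQ]] := rainbow_forest_grow fP small; first by rewrite sP.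
apply: (IH Q) => //; [by rewrite sQ | by rewrite szQ; lia].
Qed.

End Forest.

(** * Rotations *)

Section Reach.
Variables (V C : finType) (col : V -> V -> C).
Hypothesis col_sym : forall x y, col x y = col y x.
Implicit Types (p q : seq V) (a b v w x y z : V).

(** For [z] on the path this is a rotation: the part after [z] is reversed and the edge from [z] to
    its successor dropped, which makes that successor the new end. As [z] is not the end, the cyclic
    [next] is the true successor. *)
Lemma append_or_rotate x p z (l := last x p) :
  uniq (x :: p) -> z != l -> uniq (pcols col (x :: p)) ->
  col l z \notin pcols col (x :: p) ->
  exists p1,
  [/\ uniq (x :: p1), last x p1 = (if z \in x :: p then next (x :: p) z else z),
      {subset x :: p <= x :: p1} & {subset x :: p1 <= z :: x :: p}] /\
  [/\ uniq (pcols col (x :: p1)),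
      {subset pcols col (x :: p1) <= col l z :: pcols col (x :: p)}
    & forall a b, (a, b) \in epairs (x :: p1) ->
        joined (x :: p) a b || ((a, b) == if z \in x :: p then (z, l) else (l, z))].
Proof.
move=> up zl uc lz; have [zp|zp] := ifPn; last first.
  exists (rcons p z); rewrite -rcons_cons rcons_uniq zp up last_rcons.
  split; split=> //.
  - by move=> u; rewrite mem_rcons inE orbC => ->.
  - by move=> u; rewrite mem_rcons.
  - by rewrite pcols_rcons rcons_uniq lz uc.
  - by move=> u; rewrite pcols_rcons mem_rcons.
  - move=> a b; rewrite epairs_rcons mem_rcons inE => /orP[->|]; first by rewrite orbT.
    by rewrite /joined => ->.
have zw := next_epairs up zp zl; set w := next _ z in zw *.
have [q [r def_p]] := epairs_split zw.
have [q' def_q] : exists q', rcons q z = x :: q'.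
  by case: q def_p => [|y q] [<- _]; [exists [::] | exists (rcons q z)].
have last_r : l = last w r by rewrite /l -[last x p]/(last x (x :: p)) def_p last_cat.
have [t def_t] : exists t, rev (w :: r) = l :: t.
  by rewrite last_r lastI rev_rcons; eexists.
have perm_new : perm_eq (rcons q z ++ rev (w :: r)) (x :: p).
  by rewrite def_p perm_cat2l perm_rev.
have mem_new := perm_mem perm_new; have uniq_new := perm_uniq perm_new.
exists (q' ++ rev (w :: r)); rewrite -cat_cons -def_q.
have pc : pcols col (rcons q z ++ rev (w :: r)) =
    pcols col (rcons q z) ++ col l z :: rev (pcols col (w :: r)).
  by rewrite def_t pcols_rcons_cat -def_t (pcols_rev col_sym) col_sym.
have perm_c : perm_eq (col z w :: pcols col (rcons q z ++ rev (w :: r)))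
    (col l z :: pcols col (x :: p)).
  rewrite pc def_p pcols_rcons_cat; apply/permP=> g.
  by rewrite /= !count_cat /= count_rev; lia.
split; split.
- by rewrite uniq_new.
- by rewrite last_cat rev_cons last_rcons.
- by move=> u; rewrite mem_new.
- by move=> u; rewrite mem_new => ux; rewrite inE ux orbT.
- have : uniq (col l z :: pcols col (x :: p)) by rewrite cons_uniq lz.
  by rewrite -(perm_uniq perm_c) => /andP[].
- by move=> c cin; rewrite -(perm_mem perm_c) inE cin orbT.
- move=> a b; rewrite def_t epairs_rcons_cat mem_cat inE -def_t => abin.
  rewrite def_p joined_cat -(joined_rev (w :: r)) /joined.
  by case/or3P: abin => ->; rewrite ?orbT.
Qed.

Variables (fr : nat -> pred C) (s : nat).
Hypothesis fr_disj : forall i j c, fr i c -> fr j c -> i = j.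

Definition nbr i (X : {set V}) :=
  [set y | [exists x in X, (x != y) && fr i (col x y)]].

Hypothesis nbr_large : forall i (X : {set V}), i < 3 -> s <= #|X| ->
  10 * #|~: nbr i X| <= #|V|.
Hypothesis deg_large : forall x, s <= #|nbr 0 [set x]|.

Lemma nbr1 i x y : (y \in nbr i [set x]) = (x != y) && fr i (col x y).
Proof.
rewrite inE; apply/existsP/idP => [[z /andP[/set1P -> //]]|xy].
by exists x; rewrite set11.
Qed.

(* [phi z] below is the new end of the path once the edge from its end to [z]
   is used; as [phi] is injective, the first step alone yields [s] ends, which
   together see almost every vertex [w].  For most [w] both path neighbours of
   [w] see [B], so it does not matter which of them the second rotation makes
   the end. *)
Lemma reach x p (B : {set V}) : uniq (x :: p) -> uniq (pcols col (x :: p)) ->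
  (forall i c, c \in pcols col (x :: p) -> ~~ fr i c) ->
  {in x :: p, forall y, y \notin B} -> s <= #|B| ->
  10 * #|[set y | (y \notin x :: p) && (y \notin B)]| <= #|V| -> 0 < #|V| ->
  exists p' b cs,
  [/\ uniq (x :: p'), {subset x :: p <= x :: p'},
      {in x :: p', forall y, y \notin B}, b \in B & size cs <= 3] /\
  [/\ uniq (col (last x p') b :: pcols col (x :: p')),
      {subset col (last x p') b :: pcols col (x :: p') <= cs ++ pcols col (x :: p)}
    & forall c, c \in cs -> exists i, fr i c].
Proof.
move=> up uc pfr pB sB U_small V0.
set l := last x p.
have freshN i c : fr i c -> c \notin pcols col (x :: p).
  by move=> fc; apply/negP=> /(pfr i); rewrite fc.
have [/existsP[z /andP[zB]]|noB] := boolP [exists z in B, z \in nbr 0 [set l]].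
  rewrite nbr1 => /andP[lz flz].
  exists p, z, [:: col l z]; split; split=> //.
  - by rewrite cons_uniq (freshN 0).
  - by move=> c; rewrite mem_seq1 => /eqP->; exists 0.
pose phi z := if z \in x :: p then next (x :: p) z else z.
have step1 z : z \in nbr 0 [set l] -> z \notin B ->
  exists p1,
  [/\ uniq (x :: p1), last x p1 = phi z, {subset x :: p <= x :: p1}
    & {in x :: p1, forall y, y \notin B}] /\
  [/\ uniq (pcols col (x :: p1)),
      {subset pcols col (x :: p1) <= col l z :: pcols col (x :: p)}
    & forall a b, (a, b) \in epairs (x :: p1) ->
        joined (x :: p) a b || ((a, b) == if z \in x :: p then (z, l) else (l, z))].
  rewrite nbr1 eq_sym => /andP[lz flz] zB.
  have [p1 [[H1 H2 H3 H4] HH]] := append_or_rotate up lz uc (freshN _ _ flz).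
  exists p1; split=> //; split=> // y /H4; rewrite inE => /predU1P[->|/pB] //.
pose A := phi @: nbr 0 [set l].
have inNB z : z \in nbr 0 [set l] -> z \notin B.
  by move=> zN; apply/negP=> zB; case/negP: noB; apply/existsP; exists z; rewrite zB.
have sA : s <= #|A|.
  apply: leq_trans (deg_large l) _; rewrite card_imset //.
  move=> y z; rewrite /phi; case: ifPn => yp; case: ifPn => zp.
  - exact: (can_inj (prev_next up)).
  - by move=> E; move: zp; rewrite -E mem_next yp.
  - by move=> E; move: yp; rewrite E mem_next zp.
  - by [].
(* Four exceptional sets, each of at most a tenth of the vertices, cannot cover everything. *)
have [w /and4P[wA wU wnext wprev]] : exists w,
  [&& w \in nbr 1 A, w \notin [set y | (y \notin x :: p) && (y \notin B)],
      next (x :: p) w \in nbr 2 B & prev (x :: p) w \in nbr 2 B].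
  apply/existsP; apply: contraT => /existsPn now.
  pose N i X := ~: nbr i X.
  pose U := [set y | (y \notin x :: p) && (y \notin B)].
  have cover : [set: V] \subset
      N 1 A :|: U :|: (next (x :: p) @^-1: N 2 B) :|: (prev (x :: p) @^-1: N 2 B).
    apply/subsetP=> y _; move/(_ y): now.
    have pre f (X : {set V}) : (y \in f @^-1: X) = (f y \in X) by rewrite inE.
    rewrite 3!in_setU !pre !in_setC.
    by do !case: (_ \in _).
  have cn : #|next (x :: p) @^-1: N 2 B| <= #|N 2 B|.
    rewrite -(card_imset _ (can_inj (prev_next up))).
    by apply/subset_leq_card/subsetP => _ /imsetP[y + ->]; rewrite inE.
  have cp : #|prev (x :: p) @^-1: N 2 B| <= #|N 2 B|.
    rewrite -(card_imset _ (can_inj (next_prev up))).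
    by apply/subset_leq_card/subsetP => _ /imsetP[y + ->]; rewrite inE.
  have cardU (D D' : {set V}) m : #|D| <= m -> #|D :|: D'| <= m + #|D'|.
    by move=> Dm; apply: leq_trans (leq_card_setU _ _).1 _; rewrite leq_add2r.
  have := leq_trans (subset_leq_card cover)
    (cardU _ _ _ (cardU _ _ _ (cardU _ _ _ (leqnn _)))).
  have := @nbr_large 1 A isT sA; have := @nbr_large 2 B isT sB.
  rewrite cardsT -/(N 2 B) -/(N 1 A); move: U_small; rewrite -/U; lia.
have [z zN [a def_a wa]] : exists2 z,
    z \in nbr 0 [set l] & exists2 a, a = phi z & (a != w) && fr 1 (col a w).
  move: wA; rewrite inE => /existsP[a /andP[/imsetP[z zN ->] aw]].
  by exists z => //; exists (phi z).
have := zN; rewrite nbr1 => /andP[lz flz].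
have [p1 [[up1 last1 pp1 p1B] [uc1 c1 ep1]]] := step1 z zN (inNB z zN).
case/andP: wa => aw faw.
have clash i j c : fr i c -> fr j c -> i != j -> False.
  by move=> fi fj; rewrite (fr_disj fi fj) eqxx.
have awc : col a w \notin pcols col (x :: p1).
  apply/negP=> /c1; rewrite inE => /predU1P[E|]; last by apply/negP/(freshN 1).
  by apply: (clash 0 1 _ flz); rewrite // -E.
rewrite -def_a in last1.
have [wB|wB] := boolP (w \in B).
  exists p1, w, [:: col l z; col a w]; rewrite last1; split; split=> //.
  - by rewrite cons_uniq awc.
  - move=> c; rewrite inE => /predU1P[->|/c1]; first by rewrite !inE eqxx orbT.
    by rewrite !inE => /orP[] ->; rewrite ?orbT.
  - by move=> c; rewrite !inE => /orP[] /eqP ->; [exists 0 | exists 1].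
have wp : w \in x :: p by move: wU; rewrite inE wB andbT negbK.
have wp1 := pp1 _ wp.
have [p2 [[up2 last2 pp2 p2p] [uc2 c2 _]]] : exists p2,
  [/\ uniq (x :: p2), last x p2 = next (x :: p1) w,
      {subset x :: p1 <= x :: p2} & {subset x :: p2 <= x :: p1}] /\
  [/\ uniq (pcols col (x :: p2)),
      {subset pcols col (x :: p2) <= col a w :: pcols col (x :: p1)} & True].
  have := @append_or_rotate x p1 w up1; rewrite last1 wp1 eq_sym => /(_ aw uc1 awc).
  move=> [p2 [[H1 H2 H3 H4] [H5 H6 _]]]; exists p2; split; split=> //.
  by move=> u /H4; rewrite inE => /predU1P[->|].
set y := next _ w in last2.
have wy : (w, y) \in epairs (x :: p1) by apply: next_epairs; rewrite // last1 eq_sym.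
(* If the edge [wy] stems from [x :: p], then [y] is a neighbour of [w] there. Otherwise it is the
   edge just added, and the colour of [aw] is either that of the dropped path edge or that of [lz],
   which lies in class 0; both contradict its lying in class 1. *)
have yN : y \in nbr 2 B.
  case/orP: (ep1 _ _ wy) => [/orP[/(epairs_next up) <- //|/(epairs_prev up) <- //]|].
  case: ifP => zp /eqP[wz yl].
    have zl : z != last x p by rewrite eq_sym.
    have /negP[] := freshN _ _ faw; rewrite wz def_a /phi zp col_sym.
    exact: (map_f (fun e => col e.1 e.2) (next_epairs up zp zl)).
  case: (clash 0 1 _ flz _ isT).
  by move: faw; rewrite wz def_a /phi zp col_sym.
move: yN; rewrite inE => /existsP[b /and3P[bB yb fyb]].
rewrite col_sym in fyb.
have ybc : col y b \notin pcols col (x :: p2).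
  apply/negP=> /c2; rewrite inE => /predU1P[E|/c1].
    by apply: (clash 1 2 _ faw); rewrite // -E.
  rewrite inE => /predU1P[E|]; last by apply/negP/(freshN 2).
  by apply: (clash 0 2 _ flz); rewrite // -E.
exists p2, b, [:: col l z; col a w; col y b]; rewrite last2; split; split=> //.
- by move=> u /pp1/pp2.
- by move=> u /p2p/p1B.
- by rewrite cons_uniq ybc.
- move=> c; rewrite inE => /predU1P[->|/c2]; first by rewrite !inE eqxx !orbT.
  rewrite inE => /predU1P[->|/c1]; first by rewrite !inE eqxx !orbT.
  by rewrite !inE => /orP[] ->; rewrite ?orbT.
- by move=> c; rewrite !inE => /or3P[] /eqP ->; [exists 0 | exists 1 | exists 2].
Qed.
End Reach.

(** * Absorbing the forest and closing the cycle *)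

Section Absorb.
Variables (V C : finType) (col : V -> V -> C).
Hypothesis col_sym : forall x y, col x y = col y x.
Variables (f : C -> nat) (s q0 : nat).
Implicit Types (p q : seq V) (P R : seq (seq V)) (qs : seq C).

(** [qs] lists the reserved colours spent so far; the labels below 3 are the reserved ones. *)
Definition fresh qs i c := [&& i < 3, f c == i & c \notin qs].

Hypothesis nbr_large : forall qs i (X : {set V}), size qs <= q0 -> i < 3 ->
  s <= #|X| -> 10 * #|~: nbr col (fresh qs) i X| <= #|V|.
Hypothesis deg_large : forall qs x, size qs <= q0 ->
  s <= #|nbr col (fresh qs) 0 [set x]|.
Hypothesis s_gt0 : 0 < s.
Hypothesis V_gt0 : 0 < #|V|.

Definition allowed qs c := (2 < f c) || (c \in qs).

(** Unlike in [rainbow_forest], paths may be empty, because absorbing part of a path may leave an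
    empty remainder. *)
Definition linked P qs :=
  [&& uniq (flatten P), uniq (cols col P) & all (allowed qs) (cols col P)].

Lemma allowed_fresh qs c i : allowed qs c -> ~~ fresh qs i c.
Proof.
move=> Ac; apply/negP=> /and3P[i3 /eqP fc cqs]; move: Ac.
by rewrite /allowed (negPf cqs) orbF fc; lia.
Qed.

Lemma card_uncovered (l l' : seq V) : uniq (l ++ l') ->
  #|[set y | (y \notin l) && (y \notin l')]| = #|V| - size (l ++ l').
Proof.
move=> ull; have -> : [set y | (y \notin l) && (y \notin l')] = ~: [set y in l ++ l'].
  by apply/setP=> y; rewrite !inE mem_cat negb_or.
by rewrite cardsCs setCK cardsE (card_uniqP ull).
Qed.

Lemma reach_linked x p P qs (B : seq V) : linked ((x :: p) :: P) qs ->
  size qs <= q0 -> uniq ((x :: p) ++ B) -> s <= size B ->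
  9 * #|V| <= 10 * size ((x :: p) ++ B) ->
  exists p' b cs,
  [/\ uniq (x :: p'), size p <= size p',
      {in x :: p', forall y, y \notin B}, b \in B & size cs <= 3] /\
  [/\ uniq (col (last x p') b :: pcols col (x :: p')),
      {subset col (last x p') b :: pcols col (x :: p') <= cs ++ pcols col (x :: p)}
    & {in cs, forall c, ~~ allowed qs c}].
Proof.
move=> /and3P[uP ucP aP] qsq uB sB big.
have upc : uniq (pcols col (x :: p)).
  by move: ucP; rewrite cols_cons cat_uniq => /and3P[].
have [up dis uB'] := and3P (etrans (esym (cat_uniq _ _)) uB).
have cardB : #|[set y in B]| = size B by rewrite cardsE (card_uniqP uB').
have [||||||||p' [b [cs [[H1 H2 H3 H4 H5] [H6 H7 H8]]]]] :=
  @reach V C col col_sym (fresh qs) s _ _ _ x p [set y in B] up upc.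
- by move=> i j c /and3P[_ /eqP <- _] /and3P[_ /eqP].
- by move=> i X; apply: nbr_large.
- by move=> y; apply: deg_large.
- move=> i c cp; apply: allowed_fresh; apply: (allP aP).
  by rewrite cols_cons mem_cat cp.
- by move=> y yp; rewrite inE; apply/negP=> /(hasPn dis); rewrite yp.
- by rewrite cardB.
- have -> : [set y | (y \notin x :: p) && (y \notin [set z in B])] =
      [set y | (y \notin x :: p) && (y \notin B)].
    by apply/setP=> y; rewrite !inE.
  rewrite card_uncovered //.
  have arith n m : 9 * n <= 10 * m -> 10 * (n - m) <= n by clear; lia.
  exact: (arith _ _ big).
- by [].
exists p', b, cs; split; split=> //.
- exact: (uniq_leq_size up H2).
- by move=> y /H3; rewrite inE.
- by rewrite inE in H4.
- by move=> c /H8[i fc]; apply: contraL fc; apply: allowed_fresh.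
Qed.
(** Bounds the number of absorptions still to come: each replaces a path by a remainder of less than
    half its size. The successor makes an empty path count 0 and a nonempty one at least 1. *)
Definition potential P := sumn [seq up_log 2 (size q).+1 | q <- P].

Lemma potential_half (r q : seq V) :
  2 * size r < size q -> up_log 2 (size r).+1 < up_log 2 (size q).+1.
Proof.
move: (size r) (size q) => m n mn.
have := up_logP n.+1 (isT : 1 < 2); case: (up_log 2 n.+1) => [|k]; first by lia.
by rewrite expnS => le; apply: up_log_min; lia.
Qed.

(** The rerouted path and its link to [b] use only old colours of [x :: p] and the newly spent [cs],
    while the pieces of [q] use only colours of [q]. These do not clash, because no colour of [cs]
    was allowed before. *)
Lemma linked_absorb x p P qs p' b cs q t r :
  linked ((x :: p) :: P) qs -> q \in P -> b \in q ->
  perm_eq (b :: t ++ r) q ->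
  (exists D, perm_eq (D ++ pcols col (b :: t) ++ pcols col r) (pcols col q)) ->
  uniq (x :: p') -> {in x :: p', forall y, y \notin flatten P} ->
  uniq (col (last x p') b :: pcols col (x :: p')) ->
  {subset col (last x p') b :: pcols col (x :: p') <= cs ++ pcols col (x :: p)} ->
  {in cs, forall c, ~~ allowed qs c} ->
  linked ((x :: p' ++ b :: t) :: r :: rem q P) (cs ++ qs).
Proof.
move=> /and3P[uP ucP aP] qP bq btr [D Dq] up' p'P uc' c' csN.
have Pq := perm_to_rem qP.
have fl : perm_eq ((b :: t) ++ r ++ flatten (rem q P)) (flatten P).
  by rewrite (permPr (perm_flatten Pq)) catA perm_cat2r.
have uflP : uniq (flatten P).
  by have : uniq ((x :: p) ++ flatten P) := uP; rewrite cat_uniq => /and3P[].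
set g := col _ b in uc' c' *.
pose L1 := g :: pcols col (x :: p').
pose L2 := pcols col (b :: t) ++ pcols col r ++ cols col (rem q P).
have cl : perm_eq (D ++ L2) (cols col P).
  by rewrite (permPr (perm_cols col Pq)) cols_cons /L2 !catA perm_cat2r -!catA.
have ucl : uniq (cols col P) by move: ucP; rewrite cols_cons cat_uniq => /and3P[].
have uL2 : uniq L2 by move: ucl; rewrite -(perm_uniq cl) cat_uniq => /and3P[].
have L2P c : c \in L2 -> c \in cols col P.
  by rewrite -(perm_mem cl) mem_cat orbC => ->.
have aL2 c : c \in L2 -> allowed qs c.
  by move=> /L2P cP; apply: (allP aP); rewrite cols_cons mem_cat cP orbT.
have perm_new : perm_eq (cols col ((x :: p' ++ b :: t) :: r :: rem q P)) (L1 ++ L2).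
  rewrite !cols_cons -cat_cons pcols_cat -/g -catA cat_cons -[g :: _ ++ _]cat1s.
  by rewrite perm_catCA.
apply/and3P; split.
- have -> : flatten ((x :: p' ++ b :: t) :: r :: rem q P) =
      (x :: p') ++ ((b :: t) ++ r ++ flatten (rem q P)) by rewrite /= -catA.
  rewrite cat_uniq up' (perm_uniq fl) uflP andbT andTb.
  by apply/hasPn=> y; rewrite (perm_mem fl) => yP; apply: contraL yP => /p'P.
- rewrite (perm_uniq perm_new) cat_uniq uc' uL2 andbT /=.
  apply/hasPn=> c cL2; apply/negP=> /c'; rewrite mem_cat => /orP[/csN|cp].
    by rewrite aL2.
  move: ucP; rewrite cols_cons cat_uniq => /and3P[_ /hasPn/(_ _ (L2P _ cL2))].
  by rewrite cp.
- apply/allP=> c; rewrite (perm_mem perm_new) mem_cat => /orP[/c'|/aL2].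
    rewrite mem_cat => /orP[ccs|cp].
      by rewrite /allowed mem_cat ccs orbT.
    have : allowed qs c by apply: (allP aP); rewrite cols_cons mem_cat cp.
    by rewrite /allowed mem_cat => /orP[] ->; rewrite ?orbT.
  by rewrite /allowed mem_cat => /orP[] ->; rewrite ?orbT.
Qed.

Lemma linked_head q P qs : linked (q :: P) qs -> linked [:: q] qs.
Proof.
rewrite /linked !cols_cons /= !cats0 !cat_uniq all_cat.
by case/and3P=> /and3P[-> _ _] /and3P[-> _ _] /andP[-> _].
Qed.

(** Each step lowers the potential and spends at most three reserved colours. The process also stops
    once fewer than [s] vertices remain to serve as targets. *)
Lemma absorb m x p P qs : linked ((x :: p) :: P) qs ->
  potential P <= m -> size qs + 3 * m <= q0 ->
  9 * #|V| <= 10 * size (flatten ((x :: p) :: P)) ->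
  exists p' qs', [/\ linked [:: x :: p'] qs', size qs' <= size qs + 3 * m &
    size (flatten ((x :: p) :: P)) <= size (x :: p') + s].
Proof.
elim: m p P qs => [|m IH] p P qs link pot qsq big.
  have flat0 : flatten P = [::].
    elim: P pot {link big} => //= -[|y q] P IHP; rewrite /potential /=.
      by rewrite up_log1.
    by rewrite leqn0 addn_eq0 up_log_eq0.
  exists p, qs; split; first exact: linked_head link.
  - exact: leq_addr.
  - by rewrite /= flat0 cats0; apply: leq_addr.
have [small|large] := ltnP (size (flatten P)) s.
  exists p, qs; split; first exact: linked_head link.
  - exact: leq_addr.
  - by rewrite /= size_cat -addSn leq_add2l ltnW.
have [|||p' [b [cs [[up' pp' p'P bP cs3] [uc' c' csN]]]]] :=
  @reach_linked x p P qs (flatten P) link _ _ large.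
- exact: leq_trans (leq_addr _ _) qsq.
- by case/and3P: link.
- by [].
have [q qP bq] := flattenP bP.
have [t [r [btr rq Dq]]] := half_split col_sym bq.
have link' := linked_absorb link qP bq btr Dq up' p'P uc' c' csN.
have sz : size (flatten ((x :: p) :: P)) <=
    size (flatten ((x :: p' ++ b :: t) :: r :: rem q P)).
  have Pq := perm_to_rem qP.
  rewrite /= !size_cat /= (perm_size (perm_flatten Pq)) /= size_cat.
  by rewrite -(perm_size btr) /= !size_cat; lia.
have [|||p2 [qs2 [link2 qs2s sz2]]] := IH _ _ _ link'.
- have := potential_half rq.
  have : potential P = potential (q :: rem q P).
    by apply: perm_sumn; apply: perm_map; apply: perm_to_rem.
  move: pot; rewrite /potential /=; lia.
- have arith a k : a <= 3 -> k + 3 * m.+1 <= q0 -> a + k + 3 * m <= q0 by clear; lia.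
  by rewrite size_cat; apply: arith.
- by apply: leq_trans big _; rewrite leq_mul2l.
exists p2, qs2; split=> //; last exact: leq_trans sz sz2.
have arith a k : a <= 3 -> a + k + 3 * m <= k + 3 * m.+1 by clear; lia.
by apply: leq_trans qs2s _; rewrite size_cat; apply: arith.
Qed.

(** The first [s] vertices are the target. The rest is rerouted, keeping its start [x], until its
    end sees some [b] among them; then [b], the target after [b] and the rerouted path form a cycle.
    Only the vertices before [b] are lost. *)
Lemma close_cycle x0 p0 qs : linked [:: x0 :: p0] qs -> size qs <= q0 ->
  s < size (x0 :: p0) -> 9 * #|V| <= 10 * size (x0 :: p0) ->
  exists b c, [/\ uniq (b :: c),
    uniq (col (last b c) b :: pcols col (b :: c)) &
    size (x0 :: p0) <= size (b :: c) + s].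
Proof.
set l := x0 :: p0 => link qsq sl big.
have [x [p def_x]] : exists x p, drop s l = x :: p.
  have : 0 < size (drop s l) by rewrite size_drop subn_gt0.
  by case: (drop s l) => [//|x p] _; exists x, p.
have [y [q def_y]] : exists y q, take s l = y :: q.
  have : 0 < size (take s l) by rewrite size_takel // ltnW.
  by case: (take s l) => [//|y q] _; exists y, q.
have sy : size (y :: q) = s by rewrite -def_y size_takel // ltnW.
have def_l : l = (y :: q) ++ x :: p by rewrite -def_y -def_x cat_take_drop.
have [ul ucl al] := and3P link.
have {}ul : uniq l by rewrite -[l]cats0.
have {}ucl : uniq (pcols col l) by rewrite -[pcols _ _]cats0; exact: ucl.
have {}al : all (allowed qs) (pcols col l) by rewrite -[pcols _ _]cats0; exact: al.
rewrite def_l in ucl al.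
have perm_l : perm_eq ((x :: p) ++ y :: q) l by rewrite perm_catC def_l.
have linkx : linked [:: x :: p] qs.
  apply/and3P; split.
  - by move: ul; rewrite -(perm_uniq perm_l) cat_uniq /= cats0 => /and3P[].
  - by move: ucl; rewrite pcols_cat cat_uniq cols_cons /= cats0 => /and3P[_ _ /andP[]].
  - by move: al; rewrite pcols_cat all_cat cols_cons /= cats0 => /and3P[].
have [|||p' [b [cs [[up' pp' p'P bq cs3] [uc' c' csN]]]]] :=
  @reach_linked x p [::] qs (y :: q) linkx qsq.
- by rewrite (perm_uniq perm_l).
- by rewrite sy.
- by rewrite (perm_size perm_l).
have [q1 [q2 def_q]] : exists q1 q2, y :: q = q1 ++ b :: q2.
  by case/splitPr: bq => q1 q2; exists q1, q2.
have sub_q z : z \in b :: q2 -> z \in y :: q by rewrite def_q mem_cat orbC => ->.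
exists b, (q2 ++ x :: p'); split; rewrite -cat_cons.
- rewrite cat_uniq up' andbT; apply/andP; split.
    move: ul; rewrite def_l cat_uniq def_q cat_uniq => /andP[/and3P[]] //.
  by apply/hasPn=> z /p'P; apply: contra; apply: sub_q.
- rewrite last_cat [last _ (x :: p')]/=.
  set g := col _ b in uc' c' *.
  rewrite pcols_cat; pose L := pcols col (b :: q2) ++ [:: col (last b q2) x].
  have [M def_M] : exists M,
      pcols col ((y :: q) ++ x :: p) = M ++ L ++ pcols col (x :: p).
    rewrite def_q -catA /=; case/lastP: (q1) => [|q1' a].
      by exists [::]; rewrite -cat_cons pcols_cat /L -catA.
    exists (pcols col (rcons q1' a) ++ [:: col a b]).
    by rewrite pcols_rcons_cat -cat_cons pcols_cat /L -!catA.
  rewrite def_M cat_uniq in ucl; case/and3P: ucl => _ _.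
  rewrite cat_uniq => /and3P[uL dis _].
  rewrite def_M all_cat [all _ (L ++ _)]all_cat in al; case/and3P: al => _ aL _.
  set h := col _ x in L def_M uL dis aL *.
  have pg : perm_eq (g :: pcols col (b :: q2) ++ h :: pcols col (x :: p'))
      (L ++ g :: pcols col (x :: p')).
    rewrite /L -catA -[g :: _ ++ _]cat1s perm_catCA perm_cat2l.
    by rewrite -[h :: pcols _ _]cat1s perm_catCA.
  rewrite (perm_uniq pg).
  rewrite cat_uniq uL uc' andbT; apply/hasPn=> c /c'; rewrite mem_cat => /orP[/csN|cp].
    by apply: contra; apply: (allP aL).
  exact: (hasPn dis).
- have := perm_size perm_l; rewrite !size_cat sy /= => <-; lia.
Qed.

(** Absorption and closing each lose at most [s] vertices. *)
Lemma rainbow_cycle_of_forest P : rainbow_forest col (fun c => 2 < f c) P ->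
  P != [::] -> 3 * (potential P).+1 <= q0 -> 2 * s < size (flatten P) ->
  9 * #|V| <= 10 * (size (flatten P) - s) ->
  exists b c, [/\ uniq (b :: c),
    uniq (col (last b c) b :: pcols col (b :: c)) &
    size (flatten P) <= size (b :: c) + 2 * s].
Proof.
case: P => [//|[|x p] P] fP _ pot sP big; first by case/and4P: fP.
have [_ u1 u2 u3] := and4P fP.
have link : linked ((x :: p) :: P) [::].
  by rewrite /linked u1 u2; apply: sub_all u3 => c; rewrite /allowed => ->.
have [|||p' [qs [link' qs3 sz]]] := @absorb (potential P) x p P [::] link.
- by [].
- by move: pot; rewrite /potential /=; lia.
- by move: big; lia.
have [|||b [c [H1 H2 H3]]] := close_cycle link'.
- by apply: leq_trans qs3 _; move: pot; rewrite /potential /=; lia.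
- by lia.
- by lia.
by exists b, c; split=> //; lia.
Qed.

End Absorb.

(** * Counting colourings *)

(** Bernoulli's inequality: with [n = a + 1], the first two binomial terms of [(a + 1) ^ (a + 1)]
    are each at least [a ^ (a + 1)]. *)
Lemma double_expn_pred n : 0 < n -> 2 * n.-1 ^ n <= n ^ n.
Proof.
case: n => // a _ /=.
have le t : a ^ t.+1 + t.+1 * a ^ t <= a.+1 ^ t.+1.
  elim: t => [|t IH]; first by rewrite !expn1 expn0; lia.
  rewrite [a.+1 ^ _]expnS; apply: leq_trans (leq_mul (leqnn _) IH).
  by rewrite 2!expnS; nia.
by apply: leq_trans (le a); rewrite [a ^ a.+1]expnS; nia.
Qed.

(** Bernoulli's inequality for the [t]-th power of [1 - 3 / (n + 3)], which is at least one half
    while [6 * t <= n + 3]; the induction clears denominators. *)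
Lemma expn_add3 n t : 6 * t <= n + 3 -> (n + 3) ^ t <= 2 * n ^ t.
Proof.
move=> tn.
have le u : u <= t -> (n + 3) ^ u * (n + 3 - 3 * u) <= n ^ u * (n + 3).
  elim: u => [|u IH] ut; first by rewrite !expn0; lia.
  have step : (n + 3) * (n + 3 - 3 * u.+1) <= n * (n + 3 - 3 * u) by nia.
  rewrite 2!expnS -!mulnA; apply: leq_trans (leq_mul (leqnn n) (IH (ltnW ut))).
  by rewrite mulnCA [X in _ <= X]mulnCA leq_mul2l step orbT.
have := le t (leqnn t); move: ((n + 3) ^ t) (n ^ t) => A B.
nia.
Qed.

Lemma leq_expl a b e : a <= b -> a ^ e <= b ^ e.
Proof. by case: e => // e ab; rewrite leq_exp2r. Qed.

Lemma expn_ratio a b k m : 2 * a ^ k <= b ^ k -> a <= b ->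
  2 ^ (m %/ k) * a ^ m <= b ^ m.
Proof.
move=> akbk ab; rewrite [in a ^ m](divn_eq m k) [in b ^ m](divn_eq m k).
rewrite !expnD mulnA; apply: leq_mul; last exact: leq_expl.
by rewrite !(mulnC _ k) !expnM -expnMn leq_expl.
Qed.

(** Each block of [(n + 3) %/ 6] factors at most doubles the ratio; the incomplete block accounts
    for the extra factor 2. *)
Lemma expn_add3_bound n m : 2 < n ->
  (n + 3) ^ m <= 2 ^ (m %/ ((n + 3) %/ 6)).+1 * n ^ m.
Proof.
move=> n2; set t := (n + 3) %/ 6.
have t6 : 6 * t <= n + 3 by rewrite mulnC leq_trunc_div.
have t0 : 0 < t by rewrite divn_gt0 //; lia.
rewrite [in (n + 3) ^ m](divn_eq m t) [in n ^ m](divn_eq m t) !expnD expnS.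
rewrite [2 * _]mulnC -mulnA [2 * _]mulnCA mulnA; apply: leq_mul.
  by rewrite !(mulnC _ t) !expnM -expnMn leq_expl // expn_add3.
by apply: expn_add3; have := ltn_pmod m t0; lia.
Qed.

Section Counting.
Variables (C : finType) (N : nat).
Implicit Types (D : {set C}) (w : 'I_N -> nat).
Notation colouring := {ffun C -> 'I_N}.

(** Labels of different colours are independent, so the sum factors over the colours; those outside
    [D] contribute [N] each. *)
Lemma sum_prod_weight D w :
  \sum_(f : colouring) \prod_(c in D) w (f c) =
  (\sum_j w j) ^ #|D| * N ^ (#|C| - #|D|).
Proof.
transitivity (\sum_(f : colouring) \prod_c (if c \in D then w (f c) else 1)).
  by apply: eq_bigr => f _; rewrite big_mkcond.
rewrite -(bigA_distr_bigA (fun c j => if c \in D then w j else 1)).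
rewrite (bigID (mem D)) /=; congr (_ * _).
  rewrite -prod_nat_const; apply: eq_bigr => c cD.
  by apply: eq_bigr => j _; rewrite cD.
have -> : #|C| - #|D| = #|~: D| by rewrite -(cardsC D) addKn.
rewrite -prod_nat_const; apply: eq_big => [c|c cD]; first by rewrite inE.
by rewrite (eq_bigr (fun=> 1)) ?sum1_card ?card_ord // => j _; rewrite (negPf cD).
Qed.

(** Markov's inequality for a product weight. The three tail bounds below are exponential moment
    estimates with different [w]. *)
Lemma card_weight_bound (A : {set colouring}) D w b :
  (forall f, f \in A -> b <= \prod_(c in D) w (f c)) ->
  #|A| * b <= (\sum_j w j) ^ #|D| * N ^ (#|C| - #|D|).
Proof.
move=> bA; rewrite -sum_prod_weight -sum_nat_const.
rewrite [leqRHS](bigID (mem A)) /=; apply: leq_trans (leq_addr _ _).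
exact: leq_sum.
Qed.

Lemma expn_split D : N ^ #|C| = N ^ #|D| * N ^ (#|C| - #|D|).
Proof. by rewrite -expnD subnKC // max_card. Qed.

(** Weight 0 on the label [i] and 1 elsewhere: each colour of [D] contributes [N - 1] instead of
    [N], which gains a factor 2 for every [N] colours. *)
Lemma card_avoid D i : 0 < N ->
  #|[set f : colouring | [forall c in D, f c != i]]| * 2 ^ (#|D| %/ N) <= N ^ #|C|.
Proof.
move=> N0; set A := [set f | _].
have := @card_weight_bound A D (fun j => j != i) 1.
rewrite muln1 => /(_ _)/wrap[].
  move=> f; rewrite inE => /forall_inP fD.
  by rewrite (eq_bigr (fun=> 1)) ?big1 // => c /fD ->.
have -> : \sum_j (j != i : nat) = N.-1.
  transitivity #|predC1 i|; last by rewrite cardC1 card_ord.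
  by rewrite -sum1_card [RHS]big_mkcond; apply: eq_bigr => j _; rewrite !inE; case: eqP.
rewrite (expn_split D) => le.
rewrite mulnC; apply: leq_trans (leq_mul (leqnn _) le) _.
rewrite mulnA leq_mul2r expn_ratio ?orbT ?leq_pred //.
exact: double_expn_pred.
Qed.

Lemma prod_2_pow D (P : pred C) (g : C -> nat) :
  (forall c, g c = if P c then 2 else 1) ->
  \prod_(c in D) g c = 2 ^ #|[set c in D | P c]|.
Proof.
move=> gP; rewrite -prod_nat_const [LHS](bigID P) /=.
rewrite [X in _ * X]big1 ?muln1 => [|c /andP[_ /negPf Pc]]; last by rewrite gP Pc.
apply: eq_big => [c|c /andP[_ Pc]]; first by rewrite inE.
by rewrite gP Pc.
Qed.

Lemma sum_1_or_2 (P : pred 'I_N) :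
  \sum_j (if P j then 2 else 1) = N + #|P|.
Proof.
transitivity (\sum_(j : 'I_N) (1 + (j \in P))).
  by apply: eq_bigr => j _; rewrite unfold_in; case: (P j).
rewrite big_split /= sum1_card card_ord -sum1_card [in RHS]big_mkcond /=.
by congr (_ + _); apply: eq_bigr => j _; case: (_ \in _).
Qed.

(** Upper tail: the reserved labels get weight 2, so the total weight per colour is at most
    [N + 3]. *)
Lemma card_many_small D k : 2 < N ->
  #|[set f : colouring | k <= #|[set c in D | f c < 3]|]| * 2 ^ k <=
  2 ^ (#|D| %/ ((N + 3) %/ 6)).+1 * N ^ #|C|.
Proof.
move=> N2; set A := [set f | _].
have le := @card_weight_bound A D (fun j => if j < 3 then 2 else 1) (2 ^ k).
apply: leq_trans (le _) _ => [f|].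
  rewrite inE => kf; rewrite (@prod_2_pow D (fun c => f c < 3)) //.
  by rewrite leq_exp2l.
rewrite sum_1_or_2 (expn_split D) mulnA leq_mul2r; apply/orP; right.
apply: leq_trans (expn_add3_bound _ N2); apply: leq_expl.
rewrite leq_add2l -[X in _ <= X](card_ord 3).
pose h (j : 'I_N) : 'I_3 := inord j.
rewrite -(@card_in_image _ _ h) ?max_card // => j j' j3 j'3 /(congr1 (@nat_of_ord _)).
by rewrite /h !inordK // => /val_inj.
Qed.

(** Lower tail: the nonzero labels get weight 2, so the total weight per colour is [2 * N - 1],
    while a labelling with few zeros has weight at least [2 ^ (#|D| - m)]. *)
Lemma card_few_zero D m : 0 < N -> m <= #|D| ->
  #|[set f : colouring | #|[set c in D | f c == 0 :> nat]| <= m]|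
    * 2 ^ (#|D| %/ (2 * N)) <= 2 ^ m * N ^ #|C|.
Proof.
move=> N0 mD; set A := [set f | _].
have le := @card_weight_bound A D
  (fun j => if j != 0 :> nat then 2 else 1) (2 ^ (#|D| - m)).
have {}le : #|A| * 2 ^ (#|D| - m) <= (2 * N).-1 ^ #|D| * N ^ (#|C| - #|D|).
  apply: leq_trans (le _) _ => [f|].
    rewrite inE => kf; rewrite (@prod_2_pow D (fun c => f c != 0 :> nat)) //.
    rewrite leq_exp2l // leq_subLR; apply: leq_trans (leq_add kf (leqnn _)).
    rewrite -(cardsID [set c | f c == 0 :> nat] D) leq_add //.
      by apply: subset_leq_card; apply/subsetP=> c; rewrite !inE.
    by apply: subset_leq_card; apply/subsetP=> c; rewrite !inE andbC.
  rewrite leq_mul2r; apply/orP; right; apply: leq_expl.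
  rewrite sum_1_or_2.
  have -> : #|[pred j : 'I_N | j != 0 :> nat]| = N.-1.
    rewrite -[in RHS](card_ord N) -(cardC1 (Ordinal N0)).
    by apply: eq_card => j; rewrite !inE.
  by lia.
have r : 2 ^ (#|D| %/ (2 * N)) * (2 * N).-1 ^ #|D| <= 2 ^ #|D| * N ^ #|D|.
  rewrite -expnMn; apply: expn_ratio (leq_pred _).
  by apply: double_expn_pred; rewrite muln_gt0.
have yz : 2 ^ #|D| = 2 ^ (#|D| - m) * 2 ^ m by rewrite -expnD subnK.
rewrite (expn_split D) -(leq_pmul2l (_ : 0 < 2 ^ (#|D| - m))) ?expn_gt0 //.
rewrite !mulnA -yz mulnC [2 ^ _ * #|A|]mulnC.
apply: leq_trans (leq_mul (leqnn _) le) _.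
by rewrite mulnA leq_mul2r r orbT.
Qed.

End Counting.

(** The constant 4 leaves room for three families of bad events at once. *)
Lemma union_bound (I F : finType) (bad : I -> {set F}) e :
  (forall i, #|bad i| * 2 ^ e <= #|F|) -> 4 * #|I| <= 2 ^ e ->
  4 * #|\bigcup_i bad i| <= #|F|.
Proof.
move=> badF Ie; rewrite -(leq_pmul2r (_ : 0 < 2 ^ e)) ?expn_gt0 //.
have le : #|\bigcup_i bad i| <= \sum_i #|bad i|.
  elim/big_rec2: _ => [|i m U _ leU]; first by rewrite cards0.
  by apply: leq_trans (leq_card_setU _ _).1 _; rewrite leq_add2l.
have le2 : #|\bigcup_i bad i| * 2 ^ e <= #|I| * #|F|.
  apply: leq_trans (leq_mul le (leqnn _)) _.
  by rewrite big_distrl -sum_nat_const; apply: leq_sum.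
rewrite -mulnA; apply: leq_trans (leq_mul (leqnn 4) le2) _.
by rewrite mulnA [#|F| * _]mulnC leq_mul.
Qed.

(** * Random reservation of colours *)

Lemma pow2_cancel a t u e d : e + u <= d -> a * 2 ^ d <= 2 ^ u * t -> a * 2 ^ e <= t.
Proof.
move=> eud le; rewrite -(leq_pmul2l (_ : 0 < 2 ^ u)) ?expn_gt0 //.
apply: leq_trans le; rewrite mulnCA leq_mul2l -expnD leq_exp2l // addnC.
by rewrite eud orbT.
Qed.

Section Reservation.
Variables (V C : finType) (col : V -> V -> C).
Hypothesis col_sym : forall x y, col x y = col y x.
Hypothesis col_inj : forall x y z, x != y -> x != z -> col x y = col x z -> y = z.
Implicit Types (X Y : seq V) (Q : seq C).

Definition star x := [set col x y | y in [set~ x]].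

Lemma card_star_sub x (P : pred C) :
  #|[set c in star x | P c]| = #|[set y | (y != x) && P (col x y)]|.
Proof.
rewrite -(@card_in_imset _ _ (col x)).
  apply: eq_card => c; rewrite inE; apply/andP/imsetP => [[/imsetP[y]]|[y]].
    by rewrite !inE => yx -> Py; exists y; rewrite ?inE ?yx.
  by rewrite inE => /andP[yx Py] ->; split=> //; apply: imset_f; rewrite !inE.
by move=> y z; rewrite !inE => /andP[yx _] /andP[zx _]; apply: col_inj; rewrite eq_sym.
Qed.

Lemma card_star x : #|star x| = #|V|.-1.
Proof.
rewrite card_in_imset ?cardsC1 // => y z; rewrite !inE => yx zx.
by apply: col_inj; rewrite eq_sym.
Qed.

Definition between X Y Q := [set c in [seq col x y | x <- X, y <- Y] | c \notin Q].

(* The hitting clause only concerns sets of size [s], which keeps the union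
   bound affordable; a larger set is handled through [s] of its vertices that
   still span linearly many colours, see [rect_large]. *)
Lemma reservation_exists N L s q k M :
  2 < N -> #|V| <= 2 ^ L -> #|C| <= #|V| ^ 2 ->
  (#|V|.-1 %/ ((N + 3) %/ 6)).+1 + (L + 2) <= k.+1 ->
  L + 2 + (s + q) <= #|V|.-1 %/ (2 * N) ->
  L * (2 * s + 2 * q) + 4 <= M %/ N ->
  exists f : {ffun C -> 'I_N},
  [/\ forall x, #|[set y | (y != x) && (f (col x y) < 3)]| <= k,
      forall x, s + q < #|[set y | (y != x) && (f (col x y) == 0 :> nat)]|
    & forall i X Y Q, i < 3 -> size X = s -> size Y = s -> size Q = q ->
        M <= #|between X Y Q| -> exists2 c, c \in between X Y Q & f c = i :> nat].
Proof.
move=> N2 VL CV Hk Hs HM; pose F := {ffun C -> 'I_N}.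
have N0 : 0 < N by apply: leq_trans N2.
have cardF : #|F| = N ^ #|C| by rewrite card_ffun card_ord.
pose bad1 x := [set f : F | k.+1 <= #|[set c in star x | f c < 3]|].
pose bad2 x := [set f : F | #|[set c in star x | f c == 0 :> nat]| <= s + q].
pose I3 := ('I_3 * s.-tuple V * s.-tuple V * q.-tuple C)%type.
pose D (i : I3) := between i.1.1.2 i.1.2 i.2.
pose bad3 (i : I3) := if M <= #|D i|
  then [set f : F | [forall c in D i, f c != widen_ord N2 i.1.1.1]] else set0.
have U1 : 4 * #|\bigcup_x bad1 x| <= #|F|.
  apply: (@union_bound _ _ _ (L + 2)) => [x|]; last by rewrite expnD mulnC leq_mul2r.
  have := card_many_small (star x) k.+1 N2; rewrite card_star -cardF.
  by apply: pow2_cancel; rewrite addnC.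
have U2 : 4 * #|\bigcup_x bad2 x| <= #|F|.
  apply: (@union_bound _ _ _ (L + 2)) => [x|]; last by rewrite expnD mulnC leq_mul2r.
  have := @card_few_zero C N (star x) (s + q) N0; rewrite card_star -cardF.
  move=> le; apply: (pow2_cancel Hs (le _)).
  by apply: leq_trans (leq_trans _ Hs) (leq_div _ _); rewrite leq_addl.
(* There are at most [3 * 2 ^ (L * (2 * s + 2 * q))] choices of a label, two vertex sequences and a
   colour sequence, by [#|C| <= #|V| ^ 2]; the [+ 4] in the exponent covers the factor
   [4 * 3 <= 16]. *)
have U3 : 4 * #|\bigcup_i bad3 i| <= #|F|.
  apply: (@union_bound _ _ _ (L * (2 * s + 2 * q) + 4)) => [i|].
    rewrite /bad3; case: ifP => [MD|_]; last by rewrite cards0.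
    have := card_avoid (D i) (widen_ord N2 i.1.1.1) N0; rewrite -cardF.
    apply: leq_trans; rewrite leq_mul2l leq_exp2l // orbC.
    by apply/orP; left; apply: leq_trans HM _; apply: leq_div2r.
  have le : #|V| ^ s * #|V| ^ s * #|C| ^ q <= 2 ^ (L * (2 * s + 2 * q)).
    rewrite -expnD addnn -mul2n mulnDr expnD; apply: leq_mul.
      by rewrite [2 ^ _]expnM leq_expl.
    rewrite mulnA [2 ^ _]expnM; apply: leq_expl; apply: leq_trans CV _.
    by rewrite [2 ^ _]expnM leq_expl.
  have e a b c : 4 * (3 * a * b * c) = a * b * c * 12 by clear; lia.
  by rewrite !card_prod !card_tuple card_ord expnD e leq_mul.
have [f fU] : exists f,
    f \notin (\bigcup_x bad1 x) :|: (\bigcup_x bad2 x) :|: (\bigcup_i bad3 i).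
  apply/existsP; apply: contraT => /existsPn all_bad.
  have : #|F| <= #|(\bigcup_x bad1 x) :|: (\bigcup_x bad2 x) :|: (\bigcup_i bad3 i)|.
    rewrite -cardsT; apply/subset_leq_card/subsetP => f _.
    by move: (all_bad f); rewrite negbK.
  have F0 : 0 < #|F| by rewrite cardF expn_gt0 N0.
  have le1 := (leq_card_setU
    ((\bigcup_x bad1 x) :|: (\bigcup_x bad2 x)) (\bigcup_i bad3 i)).1.
  have le2 := (leq_card_setU (\bigcup_x bad1 x) (\bigcup_x bad2 x)).1.
  have arith u u1 u2 u3 w v : u <= w + u3 -> w <= u1 + u2 -> 0 < v ->
    4 * u1 <= v -> 4 * u2 <= v -> 4 * u3 <= v -> v <= u -> false by clear; lia.
  exact: arith le1 le2 F0 U1 U2 U3.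
move: fU; rewrite !in_setU !negb_or => /andP[/andP[f1 f2] f3].
have nbad (I : finType) (bad : I -> {set F}) i :
  f \notin \bigcup_i bad i -> f \notin bad i.
  by apply: contra => fi; apply/bigcupP; exists i.
exists f; split=> [x|x|i X Y Q i3 sX sY sQ MD].
- by move: (nbad _ _ x f1); rewrite inE (card_star_sub x (fun c => f c < 3)) -leqNgt.
- move: (nbad _ _ x f2); rewrite inE -ltnNge.
  by rewrite (card_star_sub x (fun c => f c == 0 :> nat)).
have tX : size X == s by rewrite sX. have tY : size Y == s by rewrite sY.
have tQ : size Q == q by rewrite sQ.
pose j : I3 := (Ordinal i3, Tuple tX, Tuple tY, Tuple tQ).
move: (nbad _ _ j f3); rewrite /bad3 /D /= MD inE negb_forall.
move=> /existsP[c]; rewrite negb_imply negbK => /andP[cD /eqP fc].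
by exists c; rewrite // fc.
Qed.

End Reservation.

(** * Expansion of the reserved colours *)

Section Expansion.
Variables (V C : finType) (col : V -> V -> C).
Hypothesis col_sym : forall x y, col x y = col y x.
Hypothesis col_inj : forall x y z, x != y -> x != z -> col x y = col x z -> y = z.

Definition rect (X : {set V}) (Y : seq V) :=
  [set c in [seq col x y | x <- enum X, y <- Y]].

Lemma rectP (X : {set V}) (Y : seq V) c :
  reflect (exists x y, [/\ x \in X, y \in Y & c = col x y]) (c \in rect X Y).
Proof.
rewrite inE; apply: (iffP allpairsP) => [[[x y] [/= xX yY ->]]|[x [y [xX yY ->]]]].
  by exists x, y; split=> //; rewrite -mem_enum.
by exists (x, y); split; rewrite ?mem_enum.
Qed.

(** Double counting: colours at [x] are distinct, so at most [#|D|] edges from each [x] to [Y0] have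
    colours in [D]. If more than half of the edges from every [y] to [X] had such colours, there
    would be too many. *)
Lemma fresh_vertex (X Y0 : {set V}) (D : {set C}) : [disjoint X & Y0] ->
  0 < #|X| -> 2 * #|D| < #|Y0| ->
  exists2 y, y \in Y0 & #|X| <= 2 * #|[set x in X | col x y \notin D]|.
Proof.
move=> dis X0 DY0; apply/exists_inP; apply: contraT => /exists_inPn few.
have split_X y :
  #|X| = #|[set x in X | col x y \in D]| + #|[set x in X | col x y \notin D]|.
  rewrite -(cardsID [set x | col x y \in D] X); congr (_ + _); apply: eq_card => x.
    by rewrite !inE.
  by rewrite !inE andbC.
have many y : y \in Y0 -> #|X| <= 2 * \sum_(x in X) (col x y \in D).
  move/few; rewrite -ltnNge {1}(split_X y) => lt.
  suff -> : \sum_(x in X) (col x y \in D) = #|[set x in X | col x y \in D]|.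
    by rewrite {1}(split_X y); move: lt; clear; lia.
  rewrite -sum1dep_card big_mkcondr; apply: eq_bigr => x _.
  by case: (_ \in _).
have : \sum_(y in Y0) #|X| <= \sum_(y in Y0) 2 * \sum_(x in X) (col x y \in D).
  exact: leq_sum.
rewrite sum_nat_const -big_distrr exchange_big /=.
have deg x : x \in X -> \sum_(y in Y0) (col x y \in D) <= #|D|.
  move=> xX; suff -> : \sum_(y in Y0) (col x y \in D) =
      #|col x @: [set y in Y0 | col x y \in D]|.
    by apply/subset_leq_card/subsetP => _ /imsetP[y + ->]; rewrite inE => /andP[].
  rewrite card_in_imset; last first.
    move=> y z; rewrite !inE => /andP[yY _] /andP[zY _].
    have nx u : u \in Y0 -> x != u.
      by move=> uY; apply: contraL uY => /eqP <-; rewrite (disjointFr dis).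
    by apply: col_inj; apply: nx.
  rewrite -sum1dep_card big_mkcondr; apply: eq_bigr => y _.
  by case: (_ \in _).
have le1 : \sum_(x in X) \sum_(y in Y0) (col x y \in D) <= #|X| * #|D|.
  by rewrite -sum_nat_const; apply: leq_sum.
move=> le2; have : #|X| * #|Y0| <= #|X| * (2 * #|D|).
  rewrite mulnC; apply: leq_trans le2 _; rewrite [#|X| * _]mulnCA leq_mul2l.
  exact: le1.
by rewrite leq_pmul2l // leqNgt DY0.
Qed.

(* Greedy choice: each colour occurs at most once at a vertex of [X], so few
   colours cannot dominate the edges from [X] to many vertices. *)
Lemma rect_large (X Y0 : {set V}) m : [disjoint X & Y0] ->
  0 < m -> 2 * m <= #|Y0| -> 2 * m <= #|X| ^ 2 ->
  exists Y, [/\ size Y = #|X|, {subset Y <= Y0} & m <= #|rect X Y|].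
Proof.
move=> dis m0 mY mX.
have X0 : 0 < #|X| by case: #|X| mX => //; rewrite leqn0; move: m0; clear; lia.
(* Until [m] colours are reached, each new vertex contributes at least [#|X| / 2] of them, hence
   [#|X| ^ 2 / 2] after [#|X|] vertices. *)
suff /(_ #|X|) [Y [sY YY0 /orP[|le]]] : forall j, exists Y,
    [/\ size Y = j, {subset Y <= Y0}
      & (m <= #|rect X Y|) || (#|X| * j <= 2 * #|rect X Y|)].
- by exists Y.
- exists Y; split=> //; rewrite -(leq_pmul2l (_ : 0 < 2)) //.
  exact: leq_trans mX le.
elim=> [|j [Y [sY YY0 H]]]; first by exists [::]; split; rewrite ?muln0 ?orbT.
have rectS y : rect X Y \subset rect X (y :: Y).
  apply/subsetP=> c /rectP[x [z [xX zY ->]]]; apply/rectP; exists x, z.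
  by rewrite inE zY orbT.
have consY y : y \in Y0 -> {subset y :: Y <= Y0}.
  by move=> yY z; rewrite inE => /predU1P[->|/YY0].
have [big|small] := leqP m #|rect X Y|.
  have /card_gt0P[y yY0] : 0 < #|Y0| by move: m0 mY; clear; lia.
  exists (y :: Y); split; [by rewrite /= sY | exact: consY|].
  by rewrite (leq_trans big) // subset_leq_card.
have [|y yY0 le] := @fresh_vertex X Y0 (rect X Y) dis X0.
  by move: small mY; clear; lia.
exists (y :: Y); split; [by rewrite /= sY | exact: consY|].
apply/orP; right; move: H; rewrite leqNgt small /= => H.
pose N := [set x in X | col x y \notin rect X Y].
have : #|rect X Y| + #|N| <= #|rect X (y :: Y)|.
  have injN : {in N &, injective (col^~ y)}.
    move=> x x'; rewrite !inE => /andP[xX _] /andP[xX' _].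
    rewrite !(col_sym _ y).
    have nx u : u \in X -> y != u.
      by move=> uX; apply: contraL uX => /eqP <-; rewrite (disjointFl dis).
    by apply: col_inj; apply: nx.
  rewrite -(card_in_imset injN).
  have disN : rect X Y :&: (col^~ y @: N) = set0.
    apply/setP=> c; rewrite in_set0 in_setI; apply/negP=> /andP[cr /imsetP[x]].
    by rewrite inE => /andP[_ +] ce; rewrite -ce cr.
  have := cardsU (rect X Y) (col^~ y @: N); rewrite disN cards0 subn0 => <-.
  apply: subset_leq_card; rewrite subUset rectS; apply/subsetP=> _ /imsetP[x + ->].
  rewrite inE => /andP[xX _]; apply/rectP; exists x, y.
  by rewrite mem_head.
rewrite mulnS; move: le H; rewrite -/N; clear; lia.
Qed.

Variables (f : C -> nat) (s q M : nat).
Hypothesis s_gt0 : 0 < s.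
Hypothesis hits : forall i (X Y : seq V) Q, i < 3 -> size X = s -> size Y = s ->
  size Q = q -> M <= #|between col X Y Q| ->
  exists2 c, c \in between col X Y Q & f c = i.

(** If too many vertices were missed, [rect_large] would find [s] of them spanning at least [M + q]
    colours with [s] vertices of [X]. At least [M] of these are unspent, so one has label [i], and
    its edge reaches a missed vertex. *)
Lemma nbr_large_of_hits qs i (X : {set V}) : 0 < M ->
  10 * (2 * (M + q) + s) <= #|V| -> 2 * (M + q) <= s ^ 2 ->
  size qs <= q -> i < 3 -> s <= #|X| ->
  10 * #|~: nbr col (fresh f qs) i X| <= #|V|.
Proof.
move=> M0 Vbig sbig qsq i3 sX; rewrite leqNgt; apply/negP=> big.
have [X' sX' X'X] : exists2 X' : {set V}, #|X'| = s & X' \subset X.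
  exists [set x in take s (enum X)].
    by rewrite cardsE (card_uniqP _) ?take_uniq ?enum_uniq // size_takel // -cardE.
  by apply/subsetP=> x; rewrite inE => /mem_take; rewrite mem_enum.
set Y1 := ~: _ in big.
have dis : [disjoint X' & Y1 :\: X'].
  by rewrite -setI_eq0; apply/eqP/setP => x; rewrite !inE; case: (_ \in X').
have cY0 : 2 * (M + q) <= #|Y1 :\: X'|.
  have := cardsD Y1 X'; have := subset_leq_card (subsetIr Y1 X').
  rewrite sX'; move: Vbig big; clear; lia.
have [|||Y [sY YY0 rectM]] := @rect_large X' (Y1 :\: X') (M + q) dis.
- by rewrite addn_gt0 M0.
- by [].
- by rewrite sX'.
have [x0 x0X'] : exists x0, x0 \in X' by apply/card_gt0P; rewrite sX'.
(* [hits] asks for exactly [q] colours, so [qs] is padded with an arbitrary one. *)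
pose Q := qs ++ nseq (q - size qs) (col x0 x0).
have sQ : size Q = q by rewrite size_cat size_nseq subnKC.
have sE : size (enum X') = s by rewrite -cardE.
have [|c] := @hits i (enum X') Y Q i3 sE (etrans sY sX') sQ.
  have sub : rect X' Y \subset between col (enum X') Y Q :|: [set c in Q].
    by apply/subsetP=> c; rewrite !inE => ->; rewrite /= orNb.
  have := leq_trans (subset_leq_card sub) (leq_card_setU _ _).1.
  have : #|[set c in Q]| <= q by rewrite cardsE -sQ card_size.
  move: rectM; clear; lia.
rewrite inE => /andP[/allpairsP[[x y] /= [xX' yY cxy]] cQ] fc.
rewrite mem_enum in xX'; have := YY0 _ yY; rewrite !inE => /andP[yX' /negP[]].
apply/existsP; exists x; rewrite (subsetP X'X) //=.
have -> : x != y by apply: contraNneq yX' => <-.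
rewrite /fresh i3 -cxy fc eqxx /=.
by apply: contra cQ; rewrite mem_cat => ->.
Qed.

(** Each spent colour occurs on at most one edge at [x], so at most [q] edges are lost. *)
Lemma deg_large_of_star qs x : size qs <= q ->
  s + q < #|[set y | (y != x) && (f (col x y) == 0)]| ->
  s <= #|nbr col (fresh f qs) 0 [set x]|.
Proof.
move=> qsq big.
pose U := [set y | (y != x) && (col x y \in qs)].
have sub : [set y | (y != x) && (f (col x y) == 0)] \subset
    nbr col (fresh f qs) 0 [set x] :|: U.
  apply/subsetP=> y; rewrite in_setU nbr1 !inE => /andP[yx fy].
  by rewrite eq_sym yx /fresh fy /= orNb.
have U_small : #|U| <= q.
  have injU : {in U &, injective (col x)}.
    by move=> y z; rewrite !inE => /andP[yx _] /andP[zx _]; apply: col_inj; rewrite eq_sym.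
  rewrite -(card_in_imset injU); apply: leq_trans qsq.
  apply: leq_trans (card_size qs); apply/subset_leq_card/subsetP => _ /imsetP[y + ->].
  by rewrite inE => /andP[].
have := leq_trans (subset_leq_card sub) (leq_card_setU _ _).1.
move: big U_small; clear; lia.
Qed.

End Expansion.

(** * Choice of parameters *)

Lemma expn4_le_exp2 L : 16 <= L -> L ^ 4 <= 2 ^ L.
Proof.
move=> /subnK <-; elim: (L - 16) => [|j IH]; first by rewrite -[16]/(2 ^ 4) -expnM.
rewrite addSn [2 ^ _]expnS; apply: leq_trans (leq_mul (leqnn 2) IH).
move: (j + 16) (leq_addl j 16) => m m16.
have step : 3 * m.+1 ^ 2 <= 4 * m ^ 2 by rewrite -!mulnn; nia.
rewrite -[4]/(2 + 2) !expnD; move: step (leq_mul step step); clear; nia.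
Qed.

(** With [L = up_log 2 n], fourth powers give [L ^ 4 < 2 * n], while [L > 2 * B] gives
    [2 * B ^ 2 <= L ^ 2]; hence [B ^ 2 * L ^ 2 < n <= s ^ 2]. *)
Lemma log_le_sqrt B : exists N0, forall n, N0 <= n ->
  forall s, n <= s ^ 2 -> B * up_log 2 n <= s.
Proof.
exists (2 ^ (2 * B + 17)) => n n_large s ns.
have n1 : 1 < n by apply: leq_trans n_large; rewrite addnS expnS leq_pmulr ?expn_gt0.
have := up_log_gtn (isT : 1 < 2) n1.
have := leq_trans n_large (up_logP n (isT : 1 < 2)).
rewrite leq_exp2l //; set L := up_log 2 n => BL nL.
have L4 : L ^ 4 <= 2 * 2 ^ L.-1.
  by rewrite -expnS prednK; [apply: expn4_le_exp2 |]; move: BL; clear; lia.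
have BL2 : 2 * B ^ 2 <= L ^ 2 by rewrite -!mulnn; nia.
rewrite -leq_sqr expnMn; have : 2 * (B ^ 2 * L ^ 2) <= L ^ 4.
  by rewrite mulnA -[L ^ 4]/(L ^ (2 + 2)) expnD leq_mul2r BL2 orbT.
move: L4 nL ns; clear; lia.
Qed.

(** The choice is [s] the rounded-up square root of [n], [N] about [s / (1000 * L)], [r] about
    [s / L] and [M = n %/ 30]. The groups of conditions concern the size of [s], the random
    labelling, expansion, the forest, and the final count; [3 * s + 3] bounds the reserved colours
    spent. *)
Lemma parameters : exists N0, forall n, N0 <= n ->
  let L := up_log 2 n in exists s N r M, let d := 10 * 1000 * (L * s) in
  [/\ [/\ 0 < s, n <= s ^ 2 & s ^ 2 <= 2 * n],
      [/\ 2 < N, (n.-1 %/ ((N + 3) %/ 6)).+1 + (L + 2) <= d.+1,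
          L + 2 + (s + (3 * s + 3)) <= n.-1 %/ (2 * N)
        & L * (2 * s + 2 * (3 * s + 3)) + 4 <= M %/ N],
      [/\ 0 < M, 10 * (2 * (M + (3 * s + 3)) + s) <= n
        & 2 * (M + (3 * s + 3)) <= s ^ 2],
      [/\ 0 < r, r <= n, n <= r * d & r * (L + 1) <= s]
    & [/\ 1 < n, 0 < d & 10 * (4 * d + 2 * s) <= n]].
Proof.
(* [K] is an opaque name for 1000, so that products such as [K * K] stay symbolic. *)
have [K K_def] : exists K, K = 1000 by exists 1000.
have [N0 N0P] := log_le_sqrt (K * K); exists (N0 + 2) => n nN L.
have n1 : 1 < n by apply: leq_trans nN; rewrite leq_addl.
have L0 : 0 < L by rewrite up_log_gt0.
have [s ns smin] : exists2 s, n <= s ^ 2 & (s.-1) ^ 2 < n.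
  have ex : exists s, n <= s ^ 2 by exists n; rewrite -mulnn; move: n1; clear; nia.
  case: (ex_minnP ex) => -[|s] ns smin; first by exists 0 => //; apply: leq_trans n1.
  by exists s.+1 => //=; rewrite ltnNge; apply/negP => /smin; rewrite ltnn.
have sL : K * K * L <= s by apply: N0P ns; apply: leq_trans nN; apply: leq_addr.
have s_big : 1000 * (1000 * L) <= s by move: sL; rewrite -mulnA K_def.
have s2n : s ^ 2 <= 2 * n.
  have s4 : 4 <= s by move: s_big L0; clear; lia.
  move: smin s4; rewrite -!mulnn; case: (s) => [//|t] /= tn t3.
  have : 3 * t <= t * t by rewrite leq_mul2r; move: t3; clear; lia.
  by move: tn t3; clear; lia.
pose u := K * L; have u0 : 0 < u by rewrite muln_gt0 K_def.
pose N := s %/ u.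
have Nu : N * u <= s := leq_trunc_div s u.
have Nu' : s < N.+1 * u := ltn_ceil s u0.
have N_big : 1000 <= N by rewrite leq_divRL // /u K_def.
have NK : 1000 * (s * (L * N)) <= 2 * n.
  apply: leq_trans s2n; rewrite -mulnn.
  have -> : 1000 * (s * (L * N)) = s * (N * u) by rewrite /u K_def; clear; lia.
  by rewrite leq_mul2l Nu orbT.
pose M := n %/ 30; have M_le : M * 30 <= n := leq_trunc_div n 30.
have M_gt : n < M.+1 * 30 := ltn_ceil n (isT : 0 < 30).
have n_s : 1000 * (1000 * (L * s)) <= 2 * n.
  by apply: leq_trans s2n; rewrite -mulnn mulnA mulnA leq_mul2r -mulnA s_big orbT.
pose r := s %/ (L + 1).
have rL : r * (L + 1) <= s := leq_trunc_div s _.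
have rL' : s < r.+1 * (L + 1) by apply: ltn_ceil; rewrite addn1.
have r0 : 0 < r by rewrite divn_gt0 ?addn1 //; move: s_big L0; clear; lia.
have n_ss : n <= s * s by rewrite mulnn.
have sLs : s <= L * s by rewrite leq_pmull.
exists s, N, r, M => d; have dE : d = 10 * 1000 * (L * s) by [].
split; split=> //.
- by move: s_big L0; clear; lia.
- by apply: leq_trans N_big.
- pose t := (N + 3) %/ 6; rewrite -/t.
  have t9 : N.+1 <= 9 * t.
    have : N + 3 < t.+1 * 6 := ltn_ceil (N + 3) (isT : 0 < 6).
    by move: N_big; clear; lia.
  have t0 : 0 < t by move: t9; clear; lia.
  have : n.-1 %/ t < (9 * K * (L * s)).+1.
    rewrite ltn_divLR //; have : s * s <= s * (9 * t * u).
      rewrite leq_mul2l; apply/orP; right; apply: leq_trans (ltnW Nu') _.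
      by rewrite leq_mul2r t9 orbT.
    have -> : s * (9 * t * u) = 9 * K * (L * s) * t by rewrite /u; clear; lia.
    rewrite mulSn; move: n_ss n1; clear; lia.
  rewrite dE K_def; move: s_big sLs L0; clear; lia.
- rewrite leq_divRL; last by rewrite muln_gt0 /=; move: N_big; clear; lia.
  have sN : 1000 * (s * N) <= 2 * n.
    apply: leq_trans NK; rewrite leq_mul2l /= leq_mul2l; apply/orP; right.
    by rewrite leq_pmull.
  have : (L + 2 + (s + (3 * s + 3))) * (2 * N) <= 10 * s * (2 * N).
    by rewrite leq_mul2r; apply/orP; right; move: s_big L0; clear; lia.
  by move: sN n1; clear; lia.
- rewrite leq_divRL; last by move: N_big; clear; lia.
  have : (L * (2 * s + 2 * (3 * s + 3)) + 4) * N <= 9 * (L * s) * N.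
    rewrite leq_mul2r; apply/orP; right.
    have : 20 * L <= L * s.
      by rewrite mulnC leq_mul2l; apply/orP; right; move: s_big L0; clear; lia.
    by move: L0; clear; lia.
  move: NK M_gt n_s sLs s_big L0; clear; lia.
- by move: M_gt n_s sLs s_big L0; clear; lia.
- by move: M_le n_s sLs s_big L0; clear; lia.
- by rewrite -mulnn; move: n_ss M_le n_s sLs s_big L0; clear; lia.
- by move: n_s sLs rL; clear; nia.
- have : s <= 2 * (r * L) + 2 * r.
    by move: rL' r0 L0; clear; nia.
  move=> sr; have : s * s <= (4 * (r * L)) * s.
    by rewrite leq_mul2r; apply/orP; right; move: sr L0 r0; clear; nia.
  by rewrite dE; move: n_ss; clear; lia.
- by rewrite dE; move: s_big sLs L0; clear; lia.
- by rewrite dE; move: n_s sLs; clear; lia.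
Qed.

(** * Long rainbow cycles *)

Lemma potential_le (V : finType) (P : seq (seq V)) L : #|V| <= 2 ^ L ->
  uniq (flatten P) -> potential P <= size P * (L + 1).
Proof.
move=> VL uP; have small q : q \in P -> up_log 2 (size q).+1 <= L + 1.
  move=> qP; have sq : size q <= 2 ^ L.
    have /card_uniqP <- := uniq_flatten_uniq uP qP.
    exact: leq_trans (max_card _) VL.
  apply: up_log_min => //; rewrite addn1 expnS.
  by rewrite mul2n -addnn -addn1 leq_add // expn_gt0.
elim: P small {uP} => //= q P IH small; rewrite /potential /= mulSn.
apply: leq_add; first by apply: small; rewrite mem_head.
by apply: IH => q' q'P; apply: small; rewrite inE q'P orbT.
Qed.

(** The forest misses at most [4 * d] vertices, absorption and closing at most [2 * s] more. *)
Lemma long_rainbow_cycle : exists N0, forall (V C : finType) (col : V -> V -> C),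
  (forall x y, col x y = col y x) ->
  (forall x y z, x != y -> x != z -> col x y = col x z -> y = z) ->
  #|C| <= #|V| ^ 2 -> N0 <= #|V| ->
  exists s b c, [/\ s ^ 2 <= 2 * #|V|, 0 < s, uniq (b :: c),
    uniq (col (last b c) b :: pcols col (b :: c)) &
    (2 < size (b :: c)) &&
    (#|V| <= size (b :: c) + 4 * (10 * 1000 * (up_log 2 #|V| * s)) + 2 * s)].
Proof.
have [N0 N0P] := parameters; exists N0 => V C col col_sym col_inj CV VN.
have [s [N [r [M]]]] := N0P _ VN; set L := up_log 2 _; set d := 10 * 1000 * _.
case=> [[s0 Vs sV] [N2 Hd Hs HM] [M0 Vbig sbig] [r0 rV Vrd rL] [V1 d0 Vd]].
have VL : #|V| <= 2 ^ L by apply: up_logP.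
have [f [f_codeg f_star f_hit]] := reservation_exists col_inj N2 VL CV Hd Hs HM.
pose g c : nat := f c.
have g_codeg x : #|[set y | (y != x) && ~~ (2 < g (col x y))]| <= d.
  apply: leq_trans (f_codeg x); apply: subset_leq_card; apply/subsetP=> y.
  by rewrite !inE -leqNgt.
have [P [fP sP szP]] :=
  @rainbow_forest_exists V C col (fun c => 2 < g c) col_sym col_inj d d0 g_codeg
    (ltnW V1) r rV Vrd.
have [_ uP _ _] := and4P fP.
(* Three colours for each of at most [s] absorptions, and three for closing the cycle. *)
have pot : 3 * (potential P).+1 <= 3 * s + 3.
  have := potential_le VL uP; rewrite sP; move: rL; clear; lia.
have [|||||b [c [ubc uc sz]]] :=
    @rainbow_cycle_of_forest V C col col_sym g s (3 * s + 3) _ _ s0 (ltnW V1)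
      P fP _ pot.
- move=> qs i X qsq i3 sX.
  by apply: (nbr_large_of_hits col_sym col_inj s0 f_hit M0 Vbig sbig qsq i3 sX).
- by move=> qs x qsq; apply: deg_large_of_star qsq _.
- by apply: contraTneq r0 => P0; rewrite -sP P0.
- by move: szP Vd s0 V1; clear; lia.
- by move: szP Vd s0 V1; clear; lia.
by exists s, b, c; split=> //; move: szP Vd sz s0 V1; clear; lia.
Qed.

(** * Reduction from arbitrary colours to finitely many *)

Section Colours.
Variables (G : sgraph) (K : Type) (c : {set G} -> K).
Hypothesis G_complete : complete_graph G.
Hypothesis c_proper : proper_edge_coloring c.

(* Counting needs at most n^2 colours, so a colour is replaced by a chosen pair
   of endpoints of one of its edges. *)
Definition colour_class (x y : G) : G * G :=
  odflt (x, y) [pick uv | `[< c [set uv.1; uv.2] = c [set x; y] >]].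

(** The chosen pair depends only on the predicate given to [pick], hence only on the colour; the
    default in [odflt] never arises, since the edge itself qualifies. *)
Lemma colour_classP x y u v :
  colour_class x y = colour_class u v <-> c [set x; y] = c [set u; v].
Proof.
have rep a b : c [set (colour_class a b).1; (colour_class a b).2] = c [set a; b].
  rewrite /colour_class; case: pickP => [uv /asboolP //|/(_ (a, b))/asboolP []] //.
split=> [E|E]; first by rewrite -rep E rep.
rewrite /colour_class -E; case: pickP => // /(_ (x, y))/asboolP [] //.
Qed.

Lemma colour_class_sym x y : colour_class x y = colour_class y x.
Proof. by apply/colour_classP; rewrite setUC. Qed.

Lemma complete_edge x y : x != y -> [set x; y] \in edges G.
Proof.
by move=> xy; apply/imsetP; exists (x, y); rewrite // inE; apply: G_complete.
Qed.

Lemma colour_class_inj x y z : x != y -> x != z ->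
  colour_class x y = colour_class x z -> y = z.
Proof.
move=> xy xz /colour_classP E.
have /setP E2 : [set x; y] = [set x; z].
  by apply: (c_proper (v := x)); rewrite // inE complete_edge // set21.
by have := E2 y; rewrite !inE eqxx orbT eq_sym (negPf xy) /= => /esym/eqP.
Qed.

Lemma uniq_map_inj (T S : eqType) (h : T -> S) (l : seq T) :
  uniq (map h l) -> {in l &, injective h}.
Proof.
elim: l => //= a l IH /andP[al ul] x y; rewrite !inE.
case/predU1P=> [->|xl] /predU1P[->|yl] // E; last exact: IH.
  by move: al; rewrite E map_f.
by move: al; rewrite -E map_f.
Qed.

Lemma rainbow_cycleP b (p : seq G) (l := b :: p) : uniq l ->
  uniq (colour_class (last b p) b :: pcols colour_class l) -> 2 < size l ->
  graph_cycle l /\ rainbow c (cycle_edges l).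
Proof.
move=> ul; rewrite cons_uniq => /andP[closing uc] sl.
have last_next : next l (last b p) = b.
  move: ul; rewrite /l; case/lastP: (p) => [|q z] ul; first by rewrite /= eqxx.
  rewrite last_rcons -rcons_cons -(next_rotr 1) ?rotr1_rcons //.
  by rewrite /= eqxx.
have bl : last b p != b.
  move: ul sl; rewrite /l; case: (p) => [//|x q] /andP[bq _] _.
  by apply: contraNneq bq => /= E; rewrite -E mem_last.
have inj := uniq_map_inj uc.
have next_pair x : x \in l -> x != last b p -> (x, next l x) \in epairs l.
  by apply: next_epairs.
split.
  rewrite /graph_cycle sl /= /ucycleb ul andbT; apply: cycle_from_next => // x xl.
  apply: G_complete; have [->|xn] := eqVneq x (last b p); first by rewrite last_next.
  (* A consecutive pair [(x, x)] would be its own reverse. *)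
  apply: contraTneq (next_pair x xl xn) => <-; apply/negP=> xx.
  exact: (uniq_epairs_oriented ul xx xx).
have distinct x y : x \in l -> y \in l ->
    colour_class x (next l x) = colour_class y (next l y) -> x = y.
  move=> xl yl; have [->|xn] := eqVneq x (last b p);
    have [->|yn] := eqVneq y (last b p) => //.
  - rewrite last_next => E; move: closing; rewrite E => /mapP[].
    exists (y, next l y) => //.
    exact: next_pair.
  - rewrite last_next => E; move: closing; rewrite -E => /mapP[].
    exists (x, next l x) => //.
    exact: next_pair.
  - by move=> E; have := inj _ _ (next_pair x xl xn) (next_pair y yl yn) E; case.
move=> _ _ /imsetP[x xl ->] /imsetP[y yl ->] /colour_classP E.
by rewrite (distinct x y xl yl E).
Qed.

End Colours.

(** * Passage to real logarithms and square roots *)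

Import Order.TTheory GRing.Theory Num.Theory.
Local Open Scope ring_scope.

(** Rounding up adds at most 1, and [log2 n] is at least 1. *)
Lemma up_log_le_log2 (R : realType) n : (1 < n)%N ->
  (up_log 2 n)%:R <= 2 * log2 n%:R :> R.
Proof.
move=> n1; have L0 : (0 < up_log 2 n)%N by rewrite up_log_gt0.
have ln2 : 0 < ln (2 : R) by apply: ln_gt0; rewrite (ltr_nat R 1 2).
have nR : (0 : R) < n%:R by rewrite ltr0n ltnW.
have pred_le : ((up_log 2 n).-1)%:R <= log2 (n%:R : R).
  rewrite /log2 ler_pdivlMr // mulr_natl -lnXn ?ltr0n //.
  have pow_gt0 : 0 < (2 : R) ^+ (up_log 2 n).-1 by rewrite exprn_gt0 ?ltr0n.
  rewrite ler_ln ?posrE // -[2 ^+ _]natrX ler_nat ltnW //.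
  by rewrite up_log_gtn.
have one_le : 1 <= log2 (n%:R : R).
  by rewrite /log2 ler_pdivlMr // mul1r ler_ln ?posrE // (ler_nat _ 2).
by move: pred_le; rewrite -{2}(prednK L0) -[(_.-1).+1]addn1 natrD; lra.
Qed.

Lemma le_2sqrt (R : realType) s n : (s ^ 2 <= 2 * n)%N ->
  s%:R <= 2 * Num.sqrt n%:R :> R.
Proof.
move=> sn; rewrite -ler_sqr ?nnegrE ?mulr_ge0 ?sqrtr_ge0 ?ler0n //.
rewrite exprMn sqr_sqrtr ?ler0n // -!natrX -natrM ler_nat.
by apply: leq_trans sn _; rewrite leq_mul2r orbT.
Qed.

Theorem theorem5 (R : realType) :
  exists (C : R) (N : nat), forall n : nat, (N <= n)%N ->
  forall (G : sgraph) (K : Type) (c : {set G} -> K),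
    #|G| = n -> complete_graph G -> proper_edge_coloring c ->
  exists s : seq G,
    [/\ graph_cycle s,
        rainbow c (cycle_edges s) &
        n%:R - C * log2 n%:R * Num.sqrt n%:R <= (size s)%:R].
Proof.
have [N0 N0P] := long_rainbow_cycle.
(* The loss [4 * d + 2 * s] is at most [k * (L * s)] because [L] is positive; the factor 4 in the
   constant comes from [L <= 2 * log2 n] and [s <= 2 * sqrt n]. *)
pose k := (4 * (10 * 1000) + 2)%N.
exists (k%:R * 4), (N0 + 2)%N => n nN G K c cardG Gc cp.
have n1 : (1 < n)%N by apply: leq_trans nN; rewrite leq_addl.
have [] := N0P _ _ _ (colour_class_sym c) (colour_class_inj Gc cp).
- by rewrite card_prod mulnn.
- by rewrite cardG; apply: leq_trans nN; rewrite leq_addr.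
rewrite cardG => s [b [p [sn s0 ubp uc /andP[size2 big]]]].
have [cyc rb] := rainbow_cycleP Gc ubp uc size2.
exists (b :: p); split=> //.
set L := up_log 2 n in big.
have L0 : (0 < L)%N by rewrite up_log_gt0.
have {}big : (n <= size (b :: p) + k * (L * s))%N.
  apply: leq_trans big _; rewrite /k mulnDl addnA leq_add ?leq_mul2l ?leq_pmull //.
  by rewrite leq_add2l !mulnA.
have := ler_pM (ler0n R L) (ler0n R s) (up_log_le_log2 R n1) (le_2sqrt R sn).
move: (log2 _) (Num.sqrt _) => l r Lslr.
rewrite lerBlDr; apply: (@le_trans _ _ ((size (b :: p))%:R + k%:R * (L%:R * s%:R))).
  by rewrite -natrM -natrM -natrD ler_nat.
rewrite lerD2l -!mulrA ler_wpM2l ?ler0n //; apply: le_trans Lslr _.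
by rewrite mulrACA -natrM.
Qed.
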